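(* Let $\|\cdot\|$ be a diagonally weighted $\ell_1$ or $\ell_\infty$ norm on $\mathbb{R}^n$, let $F:\mathbb{R}^n\to\mathbb{R}^n$ be Lipschitz continuous with respect to $\|\cdot\|$, let $G:\mathbb{R}^n\to\mathbb{R}^n$ be continuous and monotone with respect to $\|\cdot\|$, and let $x^0\in\mathbb{R}^n$ be arbitrary. (i) If $F$ is strongly monotone with respect to $\|\cdot\|$ with monotonicity parameter $c>0$, then for every $\alpha\in]0,1/\mathrm{diagL}(F)]$ the iteration $x^{k+1}=J_{\alpha G}(x^k-\alpha F(x^k))$ converges to the unique zero $x^*$ of $F+G$, and for every $k\ge0$, $\|x^{k+1}-x^*\|\le(1-\alpha c)\|x^k-x^*\|$; this factor over this range is minimized at $\alpha=1/\mathrm{diagL}(F)$. (ii) If $F$ is monotone with respect to $\|\cdot\|$ and $\{x:(F+G)(x)=0\}\ne\emptyset$, then for every $\alpha\in]0,1/\mathrm{diagL}(F)]$ the iteration $x^{k+1}=\tfrac12x^k+\tfrac12J_{\alpha G}(x^k-\alpha F(x^k))$ converges to a zero of $F+G$.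
   Context: For $\eta\in\mathbb{R}^n_{>0}$, the diagonally weighted norms are $\|x\|_{1,[\eta]}=\sum_i\eta_i|x_i|$ and $\|x\|_{\infty,[\eta]^{-1}}=\max_i|x_i|/\eta_i$. A weak pairing (WP) on $\mathbb{R}^n$ is a map $[\![\cdot,\cdot]\!]:\mathbb{R}^n\times\mathbb{R}^n\to\mathbb{R}$ that is subadditive and continuous in its first argument, satisfies $[\![\alpha x,y]\!]=[\![x,\alpha y]\!]=\alpha[\![x,y]\!]$ for $\alpha\ge0$ and $[\![-x,-y]\!]=[\![x,y]\!]$, $[\![x,x]\!]>0$ for $x\ne0$, and $|[\![x,y]\!]|\le[\![x,x]\!]^{1/2}[\![y,y]\!]^{1/2}$; it is compatible with a norm if $[\![x,x]\!]=\|x\|^2$. WPs are assumed to also satisfy Deimling's inequality $[\![x,y]\!]\le\|y\|\lim_{h\to0^+}h^{-1}(\|y+hx\|-\|y\|)$ and the curve norm derivative formula ($\|x(t)\|D^+\|x(t)\|=[\![\dot x(t),x(t)]\!]$ a.e. for differentiable curves). A map $H$ is monotone with monotonicity parameter $c\ge0$ w.r.t. $\|\cdot\|$ if for some compatible WP, $-[\![-(H(x)-H(y)),x-y]\!]\ge c\|x-y\|^2$ for all $x,y$ (monotone: $c=0$; strongly monotone: $c>0$). For continuous monotone $G$ and $\alpha>0$, $J_{\alpha G}=(\mathrm{Id}+\alpha G)^{-1}$ is single-valued and defined on all of $\mathbb{R}^n$. For Lipschitz $F$, $\mathrm{diagL}(F):=\sup_{x\in\mathbb{R}^n\setminus\Omega_F}\max_{i}(DF(x))_{ii}$,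 where $\Omega_F$ is the measure-zero set where $F$ is not differentiable. *)

(* Defs.v *)
From HB Require Import structures.
From mathcomp Require Import all_boot all_order all_algebra.
From mathcomp Require Import all_classical all_reals all_analysis.
Set Implicit Arguments. Unset Strict Implicit. Unset Printing Implicit Defensive.
Import Order.TTheory GRing.Theory Num.Theory.
Import numFieldNormedType.Exports.
Local Open Scope classical_set_scope.
Local Open Scope ring_scope.

Inductive wkind := WL1 | WLinf.

Definition wnorm {R : realType} {n : nat} (k : wkind) (eta : 'rV[R]_n)
  (x : 'rV[R]_n) : R :=
  match k with
  | WL1 => \sum_(i < n) eta 0 i * `|x 0 i|
  | WLinf => \big[Num.max/0]_(i < n) (`|x 0 i| / eta 0 i)
  end.

Definition dini_upper_right {R : realType} (f : R -> R) (t : R) : \bar R :=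
  limf_esup (fun h => ((f (t + h) - f t) / h)%:E) (0^'+).

(* [[.,.]] is a weak pairing compatible with the norm N, satisfying also
   Deimling's inequality and the curve norm derivative formula. *)
Definition compatible_WP {R : realType} {n : nat} (N : 'rV[R]_n -> R)
  (wp : 'rV[R]_n -> 'rV[R]_n -> R) : Prop :=
      (forall x1 x2 y, wp (x1 + x2) y <= wp x1 y + wp x2 y) /\
      (forall y, continuous (fun x => wp x y)) /\
      (forall (a : R) x y, 0 <= a ->
         wp (a *: x) y = a * wp x y /\ wp x (a *: y) = a * wp x y) /\
      (forall x y, wp (- x) (- y) = wp x y) /\
      (forall x, x != 0 -> 0 < wp x x) /\
      (forall x y, `|wp x y| <= Num.sqrt (wp x x) * Num.sqrt (wp y y)) /\
      (forall x, wp x x = N x ^+ 2) /\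
      (forall x y, wp x y <=
         N y * lim ((fun h : R => (N (y + h *: x) - N y) / h) @ 0^'+)) /\
      (forall c : R -> 'rV[R]_n, (forall t, derivable c t 1) ->
         {ae (@lebesgue_measure R), forall t,
            ((N (c t))%:E * dini_upper_right (fun s => N (c s)) t
             = (wp (derive1 c t) (c t))%:E)%E}).

Definition monotone_with {R : realType} {n : nat} (N : 'rV[R]_n -> R)
  (H : 'rV[R]_n -> 'rV[R]_n) (c : R) : Prop :=
  exists wp, compatible_WP N wp /\
    forall x y, - wp (- (H x - H y)) (x - y) >= c * N (x - y) ^+ 2.

Definition lipschitz_wrt {R : realType} {n : nat} (N : 'rV[R]_n -> R)
  (F : 'rV[R]_n -> 'rV[R]_n) : Prop :=
  exists L : R, forall x y, N (F x - F y) <= L * N (x - y).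

Definition diagL {R : realType} {n : nat} (F : 'rV[R]_n -> 'rV[R]_n) : R :=
  sup [set r | exists (x : 'rV[R]_n) (i : 'I_n),
                 differentiable F x /\ r = jacobian F x i i].

Definition resolvent {R : realType} {n : nat} (a : R)
  (G : 'rV[R]_n -> 'rV[R]_n) (y : 'rV[R]_n) : 'rV[R]_n :=
  get [set x | x + a *: G x = y].

Fixpoint fb_iter {R : realType} {n : nat} (a : R) (F G : 'rV[R]_n -> 'rV[R]_n)
  (x0 : 'rV[R]_n) (k : nat) : 'rV[R]_n :=
  match k with
  | 0 => x0
  | k.+1 => let x := fb_iter a F G x0 k in resolvent a G (x - a *: F x)
  end.

Fixpoint fb_avg_iter {R : realType} {n : nat} (a : R) (F G : 'rV[R]_n -> 'rV[R]_n)
  (x0 : 'rV[R]_n) (k : nat) : 'rV[R]_n :=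
  match k with
  | 0 => x0
  | k.+1 => let x := fb_avg_iter a F G x0 k in
            2^-1 *: x + 2^-1 *: resolvent a G (x - a *: F x)
  end.

(* Main.v *)
Require Import Defs.
From HB Require Import structures.
From mathcomp Require Import all_boot all_order all_algebra.
From mathcomp Require Import all_classical all_reals all_analysis.
From mathcomp Require Import measurable_realfun ring lra.
Import Order.TTheory GRing.Theory Num.Theory.
Import numFieldNormedType.Exports.
Local Open Scope classical_set_scope.
Local Open Scope ring_scope.
Set Implicit Arguments. Unset Strict Implicit. Unset Printing Implicit Defensive.

(** Every compatible weak pairing gives accretivity,
    (1 + h c) N(x - y) <= N(x - y + h (H x - H y)) for h >= 0, and this is all
    that is used of monotonicity.  The one delicate point is that diagL only sees
    the points where F is differentiable: by a vector-valued Rademacher theorem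
    and Fubini, the bound passes to all difference quotients,
    F_i (x + t e_i) - F_i x <= diagL F * t for t >= 0.  For the l_1 and l_oo norms,
    this together with accretivity makes Id - a F a (1 - a c)-contraction as soon
    as a diagL F <= 1.  Continuous strongly accretive maps are onto, which gives the
    resolvent of G and the zero of F + G; part (i) is then geometric convergence
    and part (ii) is the Krasnoselskii-Mann theorem. *)

(** * Lipschitz functions of one real variable *)

(** For these norms and a matrix [A], the function [a -> ||I - a A||] is affine as long as the
    diagonal of [I - a A] stays nonnegative. This is the origin of the range of [a] and of the
    factor [1 - a c]: what accretivity says for small [h] persists up to the step [1 / diagL F]. The
    argument is carried out on difference quotients, so only a one-sided slope bound has to be
    extracted from the Jacobians. The weak pairings of [F] and [G] may differ, so their inequalities
    cannot be added. Strong accretivity of [F + G] comes instead from the contraction property of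
    [Id - a F] and the accretivity of [G]. [G] is only continuous, so zeros are obtained from
    explicit Euler steps and uniform continuity on a ball. The norms are not strictly convex, so in
    part (ii) the decay of [N (x - T x)] rests on the Goebel-Kirk inequality. *)

Section OneDim.
Variable R : realType.
Local Notation mu := (@lebesgue_measure R).

Lemma lip_continuous (V W : normedModType R) (f : V -> W) (L : R) :
  (forall x y, `|f x - f y| <= L * `|x - y|) -> continuous f.
Proof.
move=> fL x; apply/cvgrPdist_le => e e0.
have L1 : 0 < `|L| + 1 by rewrite ltr_wpDl.
near=> y.
rewrite (le_trans (fL _ _))//.
have : `|x - y| <= e / (`|L| + 1).
  near: y; apply: cvgr_dist_le; [exact: cvg_id|by rewrite divr_gt0].
rewrite ler_pdivlMr// mulrC; apply: le_trans.
by rewrite ler_wpM2r// (le_trans (ler_norm _))// lerDl.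
Unshelve. all: by end_near. Qed.

Lemma continuous_add_scale (V : normedModType R) (A B : V -> V) (s : R) :
  continuous A -> continuous B -> continuous (fun x => A x + s *: B x).
Proof. by move=> cA cB x; exact: cvgD (cA x) (cvgZl_tmp (cB x)). Qed.

(* The Stieltjes measures of [f x + K x] and [K x - f x] add up to [2 K] times the
   Lebesgue measure, so the first one has a Radon-Nikodym density. The summand
   [`|D|] of [K] makes [D + K >= 0], so that below [phi] is compared with a
   nonnegative constant. *)
Lemma lip_primitive (f : R -> R) (L D a b : R) : a < b ->
  (forall x y, `|f x - f y| <= L * `|x - y|) ->
  exists phi : R -> R, [/\ forall x, 0 <= phi x,
     mu.-integrable setT (EFin \o phi) &
     forall x, x \in `[a, b] ->
     (f x + (`|L| + `|D| + 1) * x - (f a + (`|L| + `|D| + 1) * a))%:E =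
       (\int[mu]_(t in `]a, x]) (phi t)%:E)%E].
Proof.
move=> ab fL; set K := _ + 1.
have KL : `|L| < K by rewrite /K -addrA ltrDl ltr_wpDl.
have K0 : 0 < K by rewrite (le_lt_trans _ KL).
have fK x y : `|f x - f y| <= K * `|x - y|.
  by rewrite (le_trans (fL _ _))// ler_wpM2r// (le_trans (ler_norm _))// ltW.
have cf : continuous f := @lip_continuous R^o R^o f K fK.
have cg (s : R) : continuous (fun x => s * f x + K * x).
  move=> x; apply: cvgD; apply: cvgM => //; [exact: cvg_cst|exact: cf|exact: cvg_cst].
have ndg (s : R) : `|s| <= 1 -> {homo (fun x => s * f x + K * x) : x y / x <= y}.
  move=> s1 x y xy; rewrite -subr_ge0.
  have : `|s * (f x - f y)| <= K * (y - x).
    rewrite normrM (le_trans (ler_piMl _ _))// (le_trans (fK _ _))//.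
    by rewrite distrC ger0_norm// subr_ge0.
  by rewrite ler_norml => /andP[_]; lra.
have n1 : `|1 : R| <= 1 by rewrite normr1.
have nN1 : `|-1 : R| <= 1 by rewrite normrN1.
pose g1 : cumulative R R := HB.pack (fun x : R => 1 * f x + K * x)
  (isCumulative.Build R _ R (fun x : R => 1 * f x + K * x) (ndg 1 n1)
     (right_continuousW (cg 1))).
pose g2 : cumulative R R := HB.pack (fun x : R => -1 * f x + K * x)
  (isCumulative.Build R _ R (fun x : R => -1 * f x + K * x) (ndg (-1) nN1)
     (right_continuousW (cg (-1)))).
have K2 : 0 <= (2 * K)^-1 by rewrite invr_ge0 mulr_ge0// ltW.
pose m12 : {measure set (measurableTypeR R) -> \bar R} :=
  mscale (NngNum K2) (measure_add (lebesgue_stieltjes_measure g1) (lebesgue_stieltjes_measure g2)).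
have LSw (g : cumulative R R) X : ocitv X -> lebesgue_stieltjes_measure g X = wlength g X.
  by move=> oX; rewrite /lebesgue_stieltjes_measure /measure_extension/= measurable_mu_extE.
have m12E A : measurable A -> mu A = m12 A.
  apply: lebesgue_measure_unique => X [[c d] _ <-] /=.
  rewrite lebesgue_measure_itv/= lte_fin.
  rewrite /m12 [LHS]/= [in RHS]/= /mscale. rewrite [X in (_ * X)%E]measure_addE.
  rewrite [X in (_ * (X + _))%E]LSw ?[X in (_ * (_ + X))%E]LSw; try exact: is_ocitv.
  case: ltP => cd.
    rewrite !wlength_itv_bnd ?ltW//= -!EFinD -EFinM; congr EFin.
    by field; rewrite gt_eqF.
  by rewrite set_itv_ge ?bnd_simp -?leNgt// !wlength0 adde0 mule0.
have mab : measurable (`]a, b]%classic : set (measurableTypeR R)) by exact: measurable_itv.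
have LSE x : a <= x -> lebesgue_stieltjes_measure g1 `]a, x] = (g1 x - g1 a)%:E.
  by move=> ax; rewrite LSw; [rewrite wlength_itv_bnd|exact: is_ocitv].
have nuD : (lebesgue_stieltjes_measure g1 `]a, b] < +oo)%E by rewrite LSE ?ltW// ltry.
(* Restriction to []a, b]] makes the Stieltjes measure finite, so that its density is integrable on
   the whole line. *)
pose nu : {finite_measure set (measurableTypeR R) -> \bar R} := mfrestr mab nuD.
have numu : nu `<< mu.
  apply/null_content_dominatesP => A mA muA.
  have : m12 A = 0%E by rewrite -muA; apply/esym; exact: m12E.
  rewrite /m12 [m in m = _ -> _]/= /mscale [X in (_ * X)%E]measure_addE => /eqP.
  rewrite mule_eq0 eqe invr_eq0 gt_eqF ?mulr_gt0//= padde_eq0// => /andP[/eqP A0 _].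
  apply/eqP; rewrite eq_le measure_ge0 andbT -A0 /nu/= /mfrestr /mrestr/=.
  by rewrite le_measure ?inE//; exact: measurableI.
have [p [p0 pfin pint pE]] := radon_nikodym_sigma_finite numu.
have pK x : (fine (p x))%:E = p x by rewrite fineK.
exists (fine \o p); split => [x||x].
- exact: fine_ge0.
- rewrite (_ : EFin \o (fine \o p) = p)//; apply/funext => x /=; exact: pK.
- rewrite in_itv/= => /andP[ax xb].
  under eq_integral do rewrite /= pK.
  rewrite -pE; last exact: measurable_itv.
  rewrite /nu /= /mfrestr/= /mrestr/= (_ : _ `&` _ = `]a, x]%classic).
    rewrite LSE//=; congr EFin; lra.
  apply/seteqP; split => t /=; rewrite !in_itv/=; first by case=> /andP[-> ->].
  by move=> /andP[-> tx]; rewrite tx (le_trans tx).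
Qed.

(** At a Lebesgue point the primitive of [phi] has derivative [phi x], and [f] differs from that
    primitive by an affine function of slope [- K], but only on [[a, b]]: hence the local comparison
    of [h] with [f]. *)
Lemma lip_ae_derive_itv (f : R -> R) (L D a b : R) : a < b ->
  (forall x y, `|f x - f y| <= L * `|x - y|) ->
  exists (phi : R -> R) (K : R), [/\ forall x, 0 <= phi x, 0 <= D + K,
     mu.-integrable setT (EFin \o phi),
     (f b - f a + K * (b - a))%:E = (\int[mu]_(t in `]a, b]) (phi t)%:E)%E &
     {ae mu, forall x, x \in `]a, b[ -> is_derive x 1 f (phi x - K)}].
Proof.
move=> ab fL; have [phi [phi0 iphi phiE]] := lip_primitive D ab fL.
exists phi, (`|L| + `|D| + 1); split => //.
- by have := ler_norm (- D); rewrite normrN; have := normr_ge0 L; lra.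
- rewrite -phiE ?bound_itvE ?ltW//; congr EFin; lra.
have lphi : locally_integrable setT phi.
  by apply: open_integrable_locally => //; exact: openT.
move: (lebesgue_differentiation lphi); apply: filterS; first exact: (ae_filter_ringOfSetsType mu).
move=> x xphi; rewrite in_itv/= => /andP[ax xb].
have [||dF Fx] := @FTC1_lebesgue_pt R phi (BRight a) x b xb _ _ xphi.
- exact: integrableS iphi.
- by rewrite /= lte_fin.
set F := (X in derivable X) in dF Fx.
set K := _ + 1 in phiE *.
pose h y := F y - K * y + (f a + K * a).
have hE : \forall y \near x, h y = f y.
  near=> y.
  have aby : y \in `[a, b].
    apply: subset_itv_oo_cc; near: y; apply: near_in_itvoo.
    by rewrite in_itv/= ax.
  by rewrite /h /F /Rintegral -phiE//=; lra.
apply: (near_eq_is_derive hE).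
have dF' : is_derive x 1 F (phi x).
  by have := DeriveDef dF (erefl _); rewrite -derive1E Fx.
rewrite (_ : h = F - K \*: id + cst (f a + K * a)); last by apply/funext.
have dK : is_derive x 1 (K \*: id) (K *: 1) by exact: is_deriveZ.
have := is_deriveD (is_deriveB dF' dK) (is_derive_cst (f a + K * a) x 1).
by rewrite addr0 [K *: 1]mulr1.
Unshelve. all: by end_near. Qed.

Lemma lip_ae_derivable (f : R -> R) (L : R) :
  (forall x y, `|f x - f y| <= L * `|x - y|) ->
  {ae mu, forall x, derivable f x 1}.
Proof.
move=> fL.
have h (n : nat) : {ae mu, forall x, x \in `](- n.+1%:R), n.+1%:R[ -> derivable f x 1}.
  have n0 : - n.+1%:R < n.+1%:R :> R by rewrite (@lt_trans _ _ 0)// oppr_lt0.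
  have [phi [K [_ _ _ _]]] := lip_ae_derive_itv 0 n0 fL.
  apply: filterS; first exact: (ae_filter_ringOfSetsType mu).
  by move=> x /[apply] -[].
move/ae_foralln : h; apply: (@filterS _ _ (ae_filter_ringOfSetsType mu)).
move=> x /(_ (Num.bound `|x|)); apply; rewrite in_itv/= -ltr_norml.
by rewrite (lt_trans (archi_boundP (normr_ge0 x)))// ltr_nat.
Qed.

(** A Lipschitz function is the integral of its derivative, so a bound holding almost everywhere
    controls the increment. Adding [K] reduces it to a comparison of nonnegative functions,
    [phi <= D + K]. *)
Lemma lip_ae_derive_le (f : R -> R) (L D a b : R) : a <= b ->
  (forall x y, `|f x - f y| <= L * `|x - y|) ->
  {ae mu, forall x, x \in `]a, b[ -> derivable f x 1 -> derive1 f x <= D} ->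
  f b - f a <= D * (b - a).
Proof.
rewrite le_eqVlt => /predU1P[->|ab] fL fD; first by rewrite !subrr mulr0.
have [phi [K [phi0 DK iphi phiE dphi]]] := lip_ae_derive_itv D ab fL.
have mab : measurable (`]a, b[%classic : set (measurableTypeR R)) by exact: measurable_itv.
have mphi := measurable_funS measurableT (@subsetT _ `]a, b[%classic) (measurable_int _ iphi).
have : ((f b - f a + K * (b - a))%:E <= ((D + K) * (b - a))%:E)%E.
  rewrite phiE -integral_itv_bndo_bndc//.
  apply: (@le_trans _ _ (\int[mu]_(t in `]a, b[) (D + K)%:E)%E); last first.
    by rewrite integral_cst//= lebesgue_measure_itv/= lte_fin ab -EFinB -EFinM.
  apply: ae_ge0_le_integral => //=.
  - by move=> x _; rewrite lee_fin.
  apply: filterS2 fD dphi; first exact: (ae_filter_ringOfSetsType mu).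
  move=> x fD dphi abx; have [df xphi] := dphi abx.
  have := fD abx df; rewrite derive1E xphi lee_fin; lra.
rewrite lee_fin; lra.
Qed.

End OneDim.

(** * Null sets of R^n *)

Section ProductNull.
Context d1 d2 (T1 : measurableType d1) (T2 : measurableType d2) (R : realType).
Variable m1 : {sigma_finite_measure set T1 -> \bar R}.
Variable m2 : {sigma_finite_measure set T2 -> \bar R}.
Local Open Scope ereal_scope.

Lemma ge0_integral_eq0P d (T : measurableType d) (m : {measure set T -> \bar R})
  (f : T -> \bar R) : measurable_fun setT f -> (forall x, 0 <= f x) ->
  \int[m]_x f x = 0 <-> {ae m, forall x, f x = 0}.
Proof.
move=> mf f0; have -> : \int[m]_x f x = \int[m]_x `|f x|.
  by apply: eq_integral => x _; rewrite gee0_abs.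
rewrite (ae_eq_integral_abs m measurableT mf).
by split; apply: filterS => x; [exact|move=> ->].
Qed.

Lemma prod_null_xsection (S : set (T1 * T2)) : measurable S ->
  (m1 \x m2) S = 0 <-> {ae m1, forall x, m2 (xsection S x) = 0}.
Proof.
move=> mS; apply: ge0_integral_eq0P => //.
exact: measurable_fun_xsection.
Qed.

Lemma prod_null_ysection (S : set (T1 * T2)) : measurable S ->
  (m1 \x m2) S = 0 <-> {ae m2, forall y, m1 (ysection S y) = 0}.
Proof.
move=> mS; have -> : (m1 \x m2) S = (m1 \x^ m2) S.
  by apply: product_measure_unique => // A B mA mB; exact: product_measure2E.
apply: ge0_integral_eq0P => //.
exact: measurable_fun_ysection.
Qed.

(** The induction on the dimension takes one more product at each step, so the product must again be
    packaged as a sigma-finite measure. *)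
Lemma prod_sigma_finite : exists pm : {sigma_finite_measure set (T1 * T2)%type -> \bar R},
  forall A, pm A = (m1 \x m2) A.
Proof.
have sf : sigma_finite setT (m1 \x m2).
  have /sigma_finiteP[F [TF ndF Foo]] := sigma_finiteT m1.
  have /sigma_finiteP[G [TG ndG Goo]] := sigma_finiteT m2.
  exists (fun n => F n `*` G n).
    rewrite -setXTT TF TG predeqE => -[x y]; split.
      move=> [/= [n _ Fnx] [k _ Gky]]; exists (maxn n k) => //; split.
      - by move: x Fnx; apply/subsetPset/ndF; rewrite leq_maxl.
      - by move: y Gky; apply/subsetPset/ndG; rewrite leq_maxr.
    by move=> [n _ []/= ? ?]; split; exists n.
  move=> k; have [mF Fk] := Foo k; have [mG Gk] := Goo k.
  split; first exact: measurableX.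
  by rewrite product_measure1E// lte_mul_pinfty// ge0_fin_numE.
pose q := Measure_isSigmaFinite.Build _ _ _ (product_measure1 m1 m2) sf.
pose pm : {sigma_finite_measure set (T1 * T2)%type -> \bar R} :=
  HB.pack (product_measure1 m1 m2) q.
by exists pm.
Qed.

End ProductNull.

Section LebesgueShift.
Variable R : realType.
Local Notation mu := (@lebesgue_measure R).

Lemma lebesgue_shift (s : R) (A : set R) : measurable A ->
  mu [set t | A (t + s)] = mu A.
Proof.
move=> mA.
change (pushforward mu ((fun t => t + s) : _ -> measurableTypeR R) A = mu A).
apply/esym/lebesgue_measure_unique => //=; first exact: measurable_funD.
move=> ? X [[a b] _ <-] /=; rewrite /pushforward.
rewrite (_ : _ @^-1` _ = `]a - s, b - s]%classic).
  rewrite !lebesgue_measure_itv/= !lte_fin ltrD2r; case: ifP => // _.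
  by rewrite -!EFinB; congr EFin; ring.
by apply/seteqP; split => t /=; rewrite !in_itv/= ltrBlDr lerBrDr.
Qed.

Lemma ae_shift (s : R) (P : R -> Prop) :
  {ae mu, forall t, P t} -> {ae mu, forall t, P (t + s)}.
Proof.
move=> [N [mN N0 PN]]; exists [set t | N (t + s)]; split.
- rewrite -[X in measurable X]setTI.
  apply: (_ : measurable_fun setT (fun t : R => t + s : R)) => //.
  exact: measurable_funD.
- by rewrite lebesgue_shift.
- by move=> t /= nP; apply: PN.
Qed.

End LebesgueShift.

(** * Null sets of row vectors, by induction on the dimension *)

Section Model.
Variable R : realType.
Local Notation mu := (@lebesgue_measure R).

(** These cylinders generate the product sigma-algebra. The alias [MV] carries it, so that
    measurability of a map is checked by coordinates; [open_MV] shows that it contains the open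
    sets. *)
Definition coord_sets n : set (set 'rV[R]_n) :=
  [set A | exists (i : 'I_n) (B : set R), measurable B /\ A = [set x : 'rV[R]_n | B (x 0 i)]].

Definition MV n := g_sigma_algebraType (@coord_sets n).
HB.instance Definition _ n := Measurable.on (MV n).

Lemma measurable_MVP d (T : measurableType d) n (f : T -> 'rV[R]_n) :
  (forall i, measurable_fun setT (fun w => f w 0 i)) ->
  measurable_fun setT (f : T -> MV n).
Proof.
move=> mf; apply: (@measurability _ _ T (MV n) setT f (@coord_sets n)) => //.
move=> _ [_ [i [B [mB ->]]] <-].
exact: mf.
Qed.

Lemma measurable_coord n (i : 'I_n) : measurable_fun setT (fun x : MV n => (x : 'rV[R]_n) 0 i).
Proof.
move=> _ B mB; rewrite setTI; apply: sub_sigma_algebra.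
by exists i, B.
Qed.

Definition row_cons n (t : R) (y : 'rV[R]_n) : 'rV[R]_n.+1 :=
  \row_j (if unlift ord0 j is Some i then y 0 i else t).

(* A Lebesgue measure on R^n, given as the image by [phi] of a measure on some
   measurable space so that it can be built by induction on [n] with binary
   products; only the translation invariance of null sets is recorded. *)
Definition has_model n := exists d (T : measurableType d)
  (m : {sigma_finite_measure set T -> \bar R}) (phi : T -> 'rV[R]_n),
 [/\ forall i, measurable_fun setT (fun w => phi w 0 i),
  (forall v (A : set (MV n)), measurable A -> m (phi @^-1` A) = 0%E ->
      m [set w | A (phi w + v)] = 0%E) &
  (forall (x : 'rV[R]_n) (r : R), 0 < r ->
      (0%R < m [set w | (forall i, `|x 0 i - phi w 0 i| < r)%R])%E)].

Lemma measurable_row_cons n (A : set (MV n.+1)) (t : R) : measurable A ->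
  measurable ([set y | A (row_cons t y)] : set (MV n)).
Proof.
move=> mA; rewrite -[X in measurable X]setTI.
apply: (_ : measurable_fun setT (row_cons t : MV n -> MV n.+1)) => //.
apply: measurable_MVP => i.
case: (unliftP ord0 i) => [j|] ->.
  rewrite (_ : (fun _ => _) = (fun x : MV n => (x : 'rV[R]_n) 0 j)).
    exact: measurable_coord.
  by apply/funext => w; rewrite mxE liftK.
rewrite (_ : (fun _ => _) = cst t); first exact: measurable_cst.
by apply/funext => w; rewrite mxE unlift_none.
Qed.

Lemma has_model0 : has_model 0.
Proof.
exists _, unit, (@dirac _ unit tt R), (fun _ => 0); split.
- by case.
- move=> v A _; rewrite (_ : [set _ | _] = (fun=> 0) @^-1` A)//.
  by apply/funext => w /=; rewrite (_ : 0 + v = 0)//; apply/rowP; case.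
- move=> x r r0; suff -> : [set w : unit | forall i : 'I_0, `|x 0 i - (0 : 'rV[R]_0) 0 i| < r] = setT.
    by rewrite /= diracE in_setT lte01.
  by rewrite -subTset => w _; case.
Qed.

Lemma has_modelS n : has_model n -> has_model n.+1.
Proof.
move=> [d [T [m [phi [mphi trphi posphi]]]]].
pose phi' (w : measurableTypeR R * T) := row_cons w.1 (phi w.2).
have mphi' i : measurable_fun setT (fun w => phi' w 0 i).
  rewrite /phi'; case: (unliftP ord0 i) => [j|] ->.
    rewrite (_ : (fun _ => _) = (fun w => phi w 0 j) \o snd).
      by apply: measurableT_comp => //; exact: mphi.
    by apply/funext => w; rewrite mxE liftK.
  rewrite (_ : (fun _ => _) = fst); first exact: measurable_fst.
  by apply/funext => w; rewrite mxE unlift_none.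
have mphiv v A : measurable (A : set (MV n.+1)) -> measurable [set w | A (phi' w + v)].
  move=> mA; rewrite -[X in measurable X]setTI.
  apply: (_ : measurable_fun setT (fun w => phi' w + v : MV n.+1)) => //.
  apply: measurable_MVP => i.
  rewrite (_ : (fun _ => _) = (fun w => phi' w 0 i + v 0 i)).
    by apply: measurable_funD => //; exact: mphi'.
  by apply/funext => w; rewrite mxE.
have [pm pmE] := prod_sigma_finite mu m.
exists _, (measurableTypeR R * T)%type, pm, phi'; split => //.
- move=> v A mA.
  rewrite !pmE; have := mphiv 0 A mA; rewrite (_ : [set _ | _] = phi' @^-1` A); last first.
    by apply/funext => w /=; rewrite addr0.
  move=> mS /(prod_null_xsection mu m mS) aeA.
  apply/(prod_null_xsection mu m (mphiv v A mA)).
  (* Translation by [v] moves the first coordinate, where [ae_shift] applies, and the others by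
     [v'], where the induction hypothesis acts on almost every section. *)
  have := ae_shift (v 0 ord0) aeA.
  apply: (@filterS _ _ (ae_filter_ringOfSetsType mu)) => t; rewrite !/xsection/=.
  pose v' : 'rV_n := \row_j v 0 (lift ord0 j).
  have mAt : measurable ([set y | A (row_cons (t + v 0 ord0) y)] : set (MV n)).
    exact: measurable_row_cons.
  have E y : row_cons t y + v = row_cons (t + v 0 ord0) (y + v').
    apply/rowP => i; rewrite !mxE; case: (unliftP ord0 i) => [j|] -> //.
    by rewrite !mxE.
  rewrite (_ : [set y | _ \in phi' @^-1` A] =
    phi @^-1` [set y | A (row_cons (t + v 0 ord0) y)]); last first.
    by apply/seteqP; split=> w /=; rewrite inE.
  move/(trphi v' _ mAt); congr (m _ = _).
  by apply/seteqP; split=> w /=; rewrite inE /phi' /= E.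
- move=> x r r0; rewrite pmE.
  rewrite (_ : [set _ | _] = [set t : R | `|x 0 ord0 - t| < r] `*`
    [set w | forall i, `|(\row_j x 0 (lift ord0 j)) 0 i - phi w 0 i| < r]).
    rewrite product_measure1E; last 2 first.
    + rewrite (_ : [set t | _] = ball (x 0 ord0) r)//; exact: measurable_ball.
    + rewrite (_ : [set w | _] = \bigcap_(i : 'I_n) [set w | `|(\row_j x 0 (lift ord0 j)) 0 i - phi w 0 i| < r]).
        apply: fin_bigcap_measurable => // i _.
        rewrite -[X in measurable X]setTI.
        apply: (mphi i measurableT [set t | `|(\row_j x 0 (lift ord0 j)) 0 i - t| < r]).
        exact: measurable_ball.
      by apply/seteqP; split => w /= h; [move=> i _; exact: h|move=> i; exact: h].
    apply: mule_gt0; last exact: posphi.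
    have := lebesgue_measure_ball (x 0 ord0) (ltW r0) => E.
    apply: (@lt_le_trans _ _ (r *+ 2)%:E); first by rewrite lte_fin mulrn_wgt0.
    by rewrite -E; exact: lexx.
  apply/seteqP; split => [[t w]/= h|[t w]/= [h1 h2] i].
    split; first by have := h ord0; rewrite mxE unlift_none.
    by move=> i; have := h (lift ord0 i); rewrite !mxE liftK.
  rewrite mxE; case: (unliftP ord0 i) => [j|] -> //.
  by have := h2 j; rewrite mxE.
Qed.

Lemma model_ex n : has_model n.
Proof. by elim: n => [|n]; [exact: has_model0|exact: has_modelS]. Qed.

(* Fubini: averaging over translates along [v] relates the nullity of a set to that
   of its traces on the lines of direction [v]. *)
Lemma null_ideal_ex n : exists Nul : set (set 'rV[R]_n),
  [/\ forall F : nat -> set 'rV[R]_n, (forall k, Nul (F k)) -> Nul (\bigcup_k F k),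
      forall (A : set (MV n)) (v : 'rV[R]_n) (e : R), measurable A -> 0 < e ->
        (forall x : 'rV[R]_n, {ae mu, forall s : R, s \in `[0, e] -> ~ A (x + s *: v)}) -> Nul A &
      forall (A : set 'rV[R]_n) (v x : 'rV[R]_n) (r : R), 0 < r -> Nul A -> exists y : 'rV[R]_n,
        (forall i, `|x 0 i - y 0 i| < r) /\ {ae mu, forall s : R, ~ A (y + s *: v)}].
Proof.
have [d [T [m [phi [mphi trphi posphi]]]]] := model_ex n.
have mphi' : measurable_fun setT (phi : T -> MV n) by exact: measurable_MVP.
have mS (v : 'rV[R]_n) (A : set (MV n)) : measurable A ->
    measurable [set w : T * measurableTypeR R | A (phi w.1 + w.2 *: v)].
  move=> mA; rewrite -[X in measurable X]setTI.
  apply: (_ : measurable_fun setT (fun w : T * measurableTypeR R => phi w.1 + w.2 *: v : MV n)) => //.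
  apply: measurable_MVP => i.
  rewrite (_ : (fun _ => _) = (fun w : T * measurableTypeR R => phi w.1 0 i + w.2 * v 0 i)).
    apply: measurable_funD.
      exact: (measurableT_comp (mphi i) measurable_fst).
    by apply: measurable_funM => //; exact: measurable_snd.
  by apply/funext => w; rewrite !mxE.
exists [set A | @measurable _ (MV n) A /\ m (phi @^-1` A) = 0%E]; split.
- move=> F F0; split.
    by apply: (@bigcupT_measurable _ (MV n)) => k; case: (F0 k).
  have mF k : measurable (phi @^-1` F k).
    by rewrite -[X in measurable X]setTI; apply: mphi' => //; case: (F0 k).
  rewrite preimage_bigcup; apply/negligibleP; first exact: bigcupT_measurable.
  by apply: negligible_bigcup => k; apply/negligibleP => //; case: (F0 k).
- move=> A v e mA e0 aeA; split => //.
  have mE : measurable ([set w | w.2 \in `[0, e]] : set (T * measurableTypeR R)).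
    rewrite (_ : [set _ | _] = setT `*` `[0, e]%classic).
      by apply: measurableX => //; exact: measurable_itv.
    by apply/seteqP; split => w //= [].
  have mSE := measurableI _ _ mE (mS v A mA).
  have : (m \x mu)%E ([set w | w.2 \in `[0, e]] `&`
      [set w : T * measurableTypeR R | A (phi w.1 + w.2 *: v)]) = 0%E.
    apply/(prod_null_xsection m mu mSE); apply: aeW => w.
    apply/negligibleP; first exact: measurable_xsection.
    have [M [mM M0 PM]] := aeA (phi w); exists M; split => // s.
    by rewrite /xsection/= inE /= => -[s0 As]; apply: PM => /= /(_ s0).
  move/(prod_null_ysection m mu mSE) => [N [mN N0 PN]].
  (* [[0, e]] has positive measure, so some [s] has a null slice [A - s v]; translating back gives
     the nullity of [A]. *)
  have [s [s0 sN]] : exists s, s \in `[0, e] /\ ~ N s.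
    apply: contrapT => /forallNP h.
    have : (mu `[0%R, e]%classic <= mu N)%E.
      apply: le_measure; rewrite ?inE //. 
      by move=> s s0; apply: contrapT => sN; apply: (h s).
    by rewrite [X in (_ <= X)%E]N0 lebesgue_measure_itv/= lte_fin e0 sube0 lee_fin leNgt e0.
  have ys : m [set w | A (phi w + s *: v)] = 0%E.
    have /contrapT <- := contra_not (PN s) sN.
    congr (m _); apply/seteqP; split => w /=; rewrite /ysection/= inE /=; first by [].
    by case.
  have mAs : measurable ([set y | A (y + s *: v)] : set (MV n)).
    rewrite -[X in measurable X]setTI.
    apply: (_ : measurable_fun setT (fun y : MV n => y + s *: v : MV n)) => //.
    apply: measurable_MVP => i.
    rewrite (_ : (fun _ => _) = (fun w : MV n => (w : 'rV[R]_n) 0 i + s * v 0 i)).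
      by apply: measurable_funD => //; exact: measurable_coord.
    by apply/funext => w; rewrite !mxE.
  have := trphi (- (s *: v)) _ mAs ys.
  by congr (m _ = _); apply/seteqP; split => w /=; rewrite subrK.
- move=> A v x r r0 [mA A0].
  have : (m \x mu)%E [set w : T * measurableTypeR R | A (phi w.1 + w.2 *: v)] = 0%E.
    apply/(prod_null_ysection m mu (mS v A mA)); apply: aeW => s.
    rewrite -[RHS](trphi (s *: v) _ mA A0); congr (m _).
    by apply/seteqP; split => w /=; rewrite /ysection/= inE.
  move/(prod_null_xsection m mu (mS v A mA)) => [N [mN N0 PN]].
  have mB : measurable [set w | forall i, `|x 0 i - phi w 0 i| < r].
    rewrite (_ : [set w | _] = \bigcap_(i : 'I_n) [set w | `|x 0 i - phi w 0 i| < r]).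
      apply: fin_bigcap_measurable => // i _.
      rewrite -[X in measurable X]setTI.
      apply: (mphi i measurableT [set t | `|x 0 i - t| < r]).
      exact: measurable_ball.
    by apply/seteqP; split => w /= h; [move=> i _; exact: h|move=> i; exact: h].
  have [w [wB wN]] : exists w, (forall i, `|x 0 i - phi w 0 i| < r) /\ ~ N w.
    apply: contrapT => /forallNP h.
    have : (m [set w | (forall i, `|x 0 i - phi w 0 i| < r)%R] <= m N)%E.
      apply: le_measure; rewrite ?inE //.
      by move=> w wB; apply: contrapT => wN; apply: (h w).
    by rewrite N0 leNgt posphi.
  exists (phi w); split => //.
  have /contrapT xw := contra_not (PN w) wN.
  have mX := measurable_xsection w (mS v A mA).
  have [M [mM M0 PM]] : mu.-negligible (xsection [set w : T * measurableTypeR R | A (phi w.1 + w.2 *: v)] w).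
    by apply/negligibleP.
  exists M; split => // s /= /contrapT As; apply: PM.
  by rewrite /xsection /= inE.
Qed.

End Model.

(** * Rademacher's theorem *)

Section Rademacher.
Variables (R : realType) (n : nat).
Local Notation mu := (@lebesgue_measure R).
Local Notation V := 'rV[R]_n.

Lemma small_inv (e : R) : 0 < e -> exists k : nat, k.+1%:R^-1 < e.
Proof.
move=> e0; exists (Num.bound e^-1).
rewrite invf_plt ?posrE// (lt_trans (archi_boundP _))// ?ltr_nat//.
by rewrite invr_ge0 ltW.
Qed.

(** Boxes with rational centre and radius [1 / (k + 1)] form a countable base of measurable sets; a
    radius below [e / 2] keeps a box containing [x] inside the ball of radius [e]. *)
Lemma open_MV (U : set V) : open U -> measurable (U : set (MV R n)).
Proof.
move=> oU.
pose box (p : 'rV[rat]_n * nat) : set V :=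
  [set x | forall i, `|ratr (p.1 0 i) - x 0 i| < p.2.+1%:R^-1].
have mbox p : measurable (box p : set (MV R n)).
  rewrite (_ : box p = \bigcap_(i : 'I_n) [set x : MV R n | `|ratr (p.1 0 i) - (x : V) 0 i| < p.2.+1%:R^-1]).
    apply: (@fin_bigcap_measurable _ (MV R n)) => // i _.
    rewrite -[X in measurable X]setTI.
    apply: (@measurable_coord R n i measurableT [set t | `|ratr (p.1 0 i) - t| < p.2.+1%:R^-1]).
    exact: measurable_ball.
  by apply/seteqP; split => w /= h; [move=> i _; exact: h|move=> i; exact: h].
rewrite (_ : U = \bigcup_p (if `[< box p `<=` U >] then box p else set0)).
  apply: (@countable_bigcupT_measurable _ (MV R n)) => // p.
  by case: ifP.
apply/seteqP; split => [x Ux|x [p _]]; last by case: asboolP => // pU; exact: pU.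
have /nbhs_ballP[e /= e0 xU] : nbhs x U by exact: open_nbhs_nbhs.
have [k ke] := small_inv (divr_gt0 e0 (ltr0n R 2)).
have k0 : 0 < k.+1%:R^-1 :> R by rewrite invr_gt0.
have qP i : exists q : rat, `|ratr q - x 0 i| < k.+1%:R^-1.
  have /rat_in_itvoo[q] : x 0 i - k.+1%:R^-1 < x 0 i + k.+1%:R^-1.
    by rewrite ltrBlDr -addrA ltrDl addr_gt0.
  by rewrite in_itv/= -ltr_distl => qx; exists q.
pose q := \row_i xget 0 [set q : rat | `|ratr q - x 0 i| < k.+1%:R^-1].
have qx i : `|ratr (q 0 i) - x 0 i| < k.+1%:R^-1.
  by rewrite mxE; case: xgetP => [y -> //|nq]; have [z zP] := qP i; case: (nq z).
exists (q, k) => //; case: asboolP => [_|nU]; first exact: qx.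
exfalso; apply: nU => y yq; apply: xU; split => // i j; rewrite ord1.
have := yq j; have := qx j; rewrite distrC /ball/= => h1 h2.
rewrite (le_lt_trans (ler_distD (ratr (q 0 j)) _ _))//; move: ke h1 h2.
by set a := `|_|; set b := `|_|; set c := _^-1; lra.
Qed.

Lemma closed_MV (A : set V) : closed A -> measurable (A : set (MV R n)).
Proof.
move=> cA; rewrite -[A]setCK; apply: (@measurableC _ (MV R n)).
by apply: open_MV; exact: closed_openC.
Qed.

Variable Nul : set (set V).
Hypothesis Nul_bigcup : forall F : nat -> set V,
  (forall k, Nul (F k)) -> Nul (\bigcup_k F k).
Hypothesis Nul_lines : forall (A : set (MV R n)) (v : V) (e : R), measurable A -> 0 < e ->
  (forall x : V, {ae mu, forall s : R, s \in `[0, e] -> ~ A (x + s *: v)}) -> Nul A.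

Lemma Nul0 : Nul set0.
Proof.
apply: (@Nul_lines set0 0 1); [exact: (@measurable0 _ (MV R n))|exact: ltr01|].
by move=> x; apply: aeW => s _.
Qed.

Lemma Nul_countable (T : countType) (F : T -> set V) :
  (forall t, Nul (F t)) -> Nul (\bigcup_t F t).
Proof.
move=> F0.
rewrite (_ : \bigcup_t F t = \bigcup_k (if unpickle k is Some t then F t else set0)).
  by apply: Nul_bigcup => k; case: (unpickle k) => [t|]; [exact: F0|exact: Nul0].
apply/seteqP; split => [x [t _ Ftx]|x [k _]]; first by exists (pickle t); rewrite ?pickleK.
by case: (unpickle k) => // t Ftx; exists t.
Qed.

Variables (f : V -> R) (L : R).
Hypothesis fL : forall x y, `|f x - f y| <= L * `|x - y|.

(** Slope, scale and tolerance are explicit because each such set is closed, hence measurable, and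
    countably many of them with rational slopes describe directional differentiability. *)
Definition dquot (v : V) (p d e : R) : set V :=
  [set x | forall t, `|t| < d -> `|f (x + t *: v) - f x - t * p| <= e * `|t|].

Lemma dquot_le v p d e p' d' e' x : d' <= d -> e + `|p - p'| <= e' ->
  dquot v p d e x -> dquot v p' d' e' x.
Proof.
move=> dd ee xQ t td; have := xQ t (lt_le_trans td dd) => {}xQ.
have -> : f (x + t *: v) - f x - t * p' = f (x + t *: v) - f x - t * p + t * (p - p') by ring.
rewrite (le_trans (ler_normD _ _))// normrM.
rewrite (le_trans (lerD xQ (lexx _)))// mulrC -mulrDr mulrC.
by rewrite ler_wpM2r.
Qed.

Lemma measurable_dquot v p d e : measurable (dquot v p d e : set (MV R n)).
Proof.
apply: closed_MV.
rewrite (_ : dquot v p d e = \bigcap_(t in [set t | `|t| < d])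
   [set x | `|f (x + t *: v) - f x - t * p| <= e * `|t|]); last first.
  by apply/seteqP; split => x /= h t; exact: h.
apply: closed_bigI => t _.
have ct : continuous (fun x : V => `|f (x + t *: v) - f x - t * p|).
  apply: (@lip_continuous R V R^o _ (L + L)) => y z.
  rewrite (le_trans (ler_dist_dist _ _))// mulrDl.
  have -> : f (y + t *: v) - f y - t * p - (f (z + t *: v) - f z - t * p) =
    (f (y + t *: v) - f (z + t *: v)) - (f y - f z) by ring.
  rewrite (le_trans (ler_normB _ _))// lerD// (le_trans (fL _ _))//.
  by rewrite opprD addrACA subrr addr0.
have := (continuous_closedP _).1 ct _ (@closed_le R (e * `|t|)).
exact.
Qed.

Definition dirderivable (v : V) : set V :=
  \bigcap_(m : nat) \bigcup_(pk : rat * nat) dquot v (ratr pk.1) (pk.2.+1%:R^-1) (m.+1%:R^-1).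

Lemma measurable_dirderivable v : measurable (dirderivable v : set (MV R n)).
Proof.
apply: (@bigcapT_measurable _ (MV R n)) => m.
apply: (@countable_bigcupT_measurable _ (MV R n)) => // p.
exact: measurable_dquot.
Qed.

(** Slopes known up to [1 / (m + 1)] make the difference quotients a Cauchy filter, and completeness
    yields the exact slope. Conversely, half of the tolerance is spent on replacing [l] by a
    rational. *)
Lemma dirderivableP v x : dirderivable v x <->
  exists l, forall e, 0 < e -> exists2 d, 0 < d & dquot v l d e x.
Proof.
split => [xD|[l xl] m _]; last first.
  have e0 : 0 < (2 * m.+1%:R)^-1 :> R by rewrite invr_gt0.
  have [d d0 xd] := xl _ e0.
  have /rat_in_itvoo[p] : l - (2 * m.+1%:R)^-1 < l + (2 * m.+1%:R)^-1.
    by rewrite ltrBlDr -addrA ltrDl addr_gt0.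
  rewrite in_itv/= -ltr_distl => plm.
  have [k kd] := small_inv d0.
  exists (p, k) => //=; apply: dquot_le xd; first exact: ltW.
  have -> : m.+1%:R^-1 = (2 * m.+1%:R)^-1 + (2 * m.+1%:R)^-1 :> R by rewrite invfM -mulrDl -[LHS]mul1r; congr (_ * _); field.
  by rewrite lerD2l distrC ltW.
pose q h := (f (x + h *: v) - f x) / h.
have qQ (p d e h : R) : h != 0 -> `|h| < d -> dquot v p d e x -> `|p - q h| <= e.
  move=> h0 hd /(_ h hd) xh.
  rewrite -(@ler_pM2r _ `|h|) ?normr_gt0// -normrM mulrBl /q divfK//.
  by rewrite distrC [p * h]mulrC.
have : cauchy (q @ 0^').
  apply: cauchy_exP => e e0.
  have [m me] := small_inv e0; have [[p k] _ /= xQ] := xD m I.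
  exists (ratr p); near=> h; rewrite /ball/= (le_lt_trans _ me)//.
  apply: qQ xQ; first by near: h; exact: nbhs_dnbhs_neq.
  near: h; apply: dnbhs0_lt; by rewrite invr_gt0.
move=> /cauchy_cvg /cvg_ex[l ql]; exists l => e e0.
move/(@cvgrPdist_le R R^o) : ql => /(_ e e0).
rewrite near_withinE => /nbhs_ballP[d /= d0 dq].
exists d => // t td; have [->|t0] := eqVneq t 0.
  by rewrite scale0r addr0 subrr mul0r subrr normr0 mulr0.
have := dq t; rewrite /ball/= sub0r normrN => /(_ td t0).
rewrite distrC -(@ler_pM2r _ `|t|) ?normr_gt0// -normrM mulrBl /q divfK//.
by rewrite [l * t]mulrC.
Unshelve. all: by end_near. Qed.

Lemma Nul_not_dirderivable v : Nul (~` dirderivable v).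
Proof.
apply: (@Nul_lines _ v 1) => //.
  by apply: (@measurableC _ (MV R n)); exact: measurable_dirderivable.
move=> x; pose g (s : R) := f (x + s *: v).
have gL s t : `|g s - g t| <= L * `|v| * `|s - t|.
  rewrite (le_trans (fL _ _))// -mulrA [`|v| * _]mulrC -normrZ.
  by rewrite opprD addrACA subrr add0r -scalerBl.
have := lip_ae_derivable gL.
apply: (@filterS _ _ (ae_filter_ringOfSetsType mu)) => s dg _; apply.
apply/dirderivableP; move: dg => /cvg_ex[l gl]; exists l => e e0.
move/(@cvgrPdist_le R R^o) : gl => /(_ e e0).
rewrite near_withinE => /nbhs_ballP[d /= d0 dq].
exists d => // t td; have [->|t0] := eqVneq t 0.
  by rewrite scale0r addr0 subrr mul0r subrr normr0 mulr0.
have := dq t; rewrite /ball/= sub0r normrN => /(_ td t0).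
rewrite distrC -(@ler_pM2r _ `|t|) ?normr_gt0// -normrM mulrBl.
rewrite [_ *: _ * t]mulrC mulrA divff// mul1r /g [t *: 1]mulr1.
by rewrite scalerDl addrA [x + t *: v]addrC -addrA addrC [l * t]mulrC.
Qed.

Definition nonadditive v w p q r d e : set V :=
  dquot v p d e `&` dquot w q d e `&` dquot (v + w) r d e.

(* Two points at distance less than [d] on a line of direction [w] cannot both be in
   this set, so short segments of direction [w] meet it at most once. *)
Lemma Nul_nonadditive v w p q r d e : 0 < d -> 3 * e < `|r - p - q| ->
  Nul (nonadditive v w p q r d e).
Proof.
move=> d0 epqr.
have uniq x s s' : s \in `[0, d / 2] -> s' \in `[0, d / 2] ->
    nonadditive v w p q r d e (x + s *: w) -> nonadditive v w p q r d e (x + s' *: w) -> s = s'.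
  rewrite !in_itv/= => /andP[s0 sd] /andP[s'0 s'd] [[_ Aq] Ar] [[Ap _] _].
  apply/eqP/negPn/negP => ss'.
  have t0 : 0 < `|s' - s| by rewrite normr_gt0 subr_eq0 eq_sym.
  have td : `|s' - s| < d by rewrite ltr_norml; apply/andP; split; lra.
  have {Aq} := Aq _ td; have {Ar} := Ar _ td; have {Ap} := Ap _ td.
  rewrite (_ : x + s *: w + (s' - s) *: w = x + s' *: w); last first.
    by rewrite -addrA -scalerDl [s + _]addrC subrK.
  rewrite (_ : x + s *: w + (s' - s) *: (v + w) = x + s' *: w + (s' - s) *: v); last first.
    rewrite scalerDr addrA addrAC -[x + _ + _ *: w]addrA -scalerDl.
    by rewrite [s + _]addrC subrK.
  set a := f _; set b := f _; set c := f _ => h1 h2 h3.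
  have : `|s' - s| * `|r - p - q| <= 3 * e * `|s' - s|.
    rewrite -normrM.
    have -> : (s' - s) * (r - p - q) = (a - b - (s' - s) * p) + (b - c - (s' - s) * q) - (a - c - (s' - s) * r).
      ring.
    rewrite (le_trans (ler_normB _ _))// (le_trans (lerD (ler_normD _ _) (lexx _)))//.
    lra.
  by rewrite mulrC ler_pM2r// leNgt epqr.
apply: (@Nul_lines _ w (d / 2)).
- by do 2?apply: (@measurableI _ (MV R n)); exact: measurable_dquot.
- by rewrite divr_gt0.
- move=> x; pose S := [set s | s \in `[0, d / 2] /\ nonadditive v w p q r d e (x + s *: w)].
  have [[s0 [s0d As0]]|nS] := pselect (S !=set0).
    exists [set s0]; split; [exact: measurable_set1|exact: lebesgue_measure_set1|].
    move=> s /= /not_implyP[sd /contrapT As].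
    exact: (uniq x s s0).
  by apply: aeW => s sd As; apply: nS; exists s.
Qed.

Lemma additive_limit v w x l1 l2 l3 :
  (forall p q r k m, 3 * m.+1%:R^-1 < `|(ratr r - ratr p - ratr q : R)| ->
     ~ nonadditive v w (ratr p) (ratr q) (ratr r) (k.+1%:R^-1) (m.+1%:R^-1) x) ->
  (forall e, 0 < e -> exists2 d, 0 < d & dquot v l1 d e x) ->
  (forall e, 0 < e -> exists2 d, 0 < d & dquot w l2 d e x) ->
  (forall e, 0 < e -> exists2 d, 0 < d & dquot (v + w) l3 d e x) -> l3 = l1 + l2.
Proof.
move=> nx h1 h2 h3; apply/eqP/negPn/negP => l123.
(* Each rational slope errs by at most half of [1 / (m + 1) < e], so [|r - p - q|] exceeds [6 - 3/2]
   times [1 / (m + 1)], above the required factor 3. *)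
have e0 : 0 < `|l3 - l1 - l2| / 6 :> R.
  by rewrite divr_gt0// normr_gt0 -addrA -opprD subr_eq0.
have [m me] := small_inv e0; set e := `|_| / 6 in e0 me.
have m0 : 0 < m.+1%:R^-1 / 2 :> R by rewrite divr_gt0.
have ratP (l : R) : exists q : rat, `|l - ratr q| <= m.+1%:R^-1 / 2.
  have /rat_in_itvoo[q] : l - m.+1%:R^-1 / 2 < l + m.+1%:R^-1 / 2.
    by rewrite ltrBlDr -addrA ltrDl addr_gt0.
  by rewrite in_itv/= -ltr_distl distrC => /ltW lq; exists q.
have [[d1 d10 Q1] [d2 d20 Q2] [d3 d30 Q3]] := And3 (h1 _ m0) (h2 _ m0) (h3 _ m0).
have [[p lp] [q lq] [r lr]] := And3 (ratP l1) (ratP l2) (ratP l3).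
have [k kd] : exists k : nat, k.+1%:R^-1 < Num.min d1 (Num.min d2 d3).
  by apply: small_inv; rewrite !lt_min d10 d20.
move: kd; rewrite !lt_min => /and3P[/ltW k1 /ltW k2 /ltW k3].
have mm : m.+1%:R^-1 / 2 + m.+1%:R^-1 / 2 = m.+1%:R^-1 :> R by rewrite -splitr.
apply: (nx p q r k m).
  have -> : ratr r - ratr p - ratr q =
     (l3 - l1 - l2) - ((l3 - ratr r) - (l1 - ratr p) - (l2 - ratr q)) by ring.
  apply: lt_le_trans (lerB_dist _ _).
  have : `|l3 - l1 - l2| = 6 * e by rewrite /e; field.
  have := ler_normB (l3 - ratr r - (l1 - ratr p)) (l2 - ratr q).
  have := ler_normB (l3 - ratr r) (l1 - ratr p).
  move: me lp lq lr; set a := `|_|; set b := `|_|; set c := `|_|.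
  set u := `|_ - _|; set u' := `|_ - _|; set u'' := `|_ - _|; set j := _^-1; lra.
by split; [split|]; [apply: dquot_le Q1|apply: dquot_le Q2|apply: dquot_le Q3] => //;
  rewrite -[leRHS]mm lerD2l.
Qed.

(** Integer directions are countable and closed under addition: the slopes along them form an
    additive map, determined by its values on the unit vectors. *)
Definition intv (v : 'rV[int]_n) : V := map_mx intr v.

Definition exceptional : set V :=
  (\bigcup_v ~` dirderivable (intv v)) `|`
  (\bigcup_(i : 'rV[int]_n * 'rV[int]_n * (rat * rat * rat) * (nat * nat))
     let: (v, w, (p, q, r), (k, m)) := i in
     if 3 * m.+1%:R^-1 < `|(ratr r - ratr p - ratr q : R)| then
       nonadditive (intv v) (intv w) (ratr p) (ratr q) (ratr r) (k.+1%:R^-1) (m.+1%:R^-1)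
     else set0).

Lemma Nul_setU (A B : set V) : Nul A -> Nul B -> Nul (A `|` B).
Proof.
move=> A0 B0; rewrite (_ : A `|` B = \bigcup_(b : bool) (if b then A else B)).
  by apply: Nul_countable; case.
apply/seteqP; split => [x [Ax|Bx]|x [[] _]]; [by exists true|by exists false|by left|by right].
Qed.

Lemma Nul_exceptional : Nul exceptional.
Proof.
apply: Nul_setU.
  by apply: Nul_countable => v; exact: Nul_not_dirderivable.
apply: Nul_countable => -[[[v w] [[p q] r]] [k m]]; case: ifP => h; last exact: Nul0.
exact: Nul_nonadditive.
Qed.

Lemma rV_norm_le (x : V) r : 0 <= r -> (forall i, `|x 0 i| <= r) -> `|x| <= r.
Proof.
move=> r0 xr; rewrite [`|x|]mx_normrE; apply/bigmax_leP; split => // -[i j] _ /=.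
by rewrite ord1.
Qed.

Lemma rV_coord_le (x : V) i : `|x 0 i| <= `|x|.
Proof. by rewrite [`|x|]mx_normrE; exact: (le_bigmax _ (fun ij => `|x ij.1 ij.2|) (ord0, i)). Qed.

(* Up to a factor, any increment is close to one of finitely many integer vectors;
   [f] being Lipschitz, integer directions are enough. *)
Lemma not_exceptional x : ~ exceptional x -> exists l : 'I_n -> R,
  forall e, 0 < e -> exists2 d, 0 < d &
    forall y, `|y| < d -> `|f (x + y) - f x - \sum_i y 0 i * l i| <= e * `|y|.
Proof.
move=> nE.
have /choice[lam lamP] (v : 'rV[int]_n) : exists l, forall e, 0 < e ->
    exists2 d, 0 < d & dquot (intv v) l d e x.
  by apply/dirderivableP; apply: contrapT => h; apply: nE; left; exists v.
have lamD v w : lam (v + w) = lam v + lam w.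
  apply: (@additive_limit (intv v) (intv w) x) => [p q r k m pqr h|||]; [|exact: lamP|exact: lamP|].
    by apply: nE; right; exists (v, w, (p, q, r), (k, m)) => //=; rewrite pqr.
  have -> : intv v + intv w = intv (v + w) by rewrite /intv map_mxD.
  exact: lamP.
have lamB : zmod_morphism lam.
  by move=> v w; apply/eqP; rewrite eq_sym subr_eq -lamD subrK.
pose lamA : {additive 'rV[int]_n -> R} := HB.pack lam (GRing.isZmodMorphism.Build _ _ lam lamB).
pose l i := lam (delta_mx 0 i); exists l.
have lamE v : lam v = \sum_i (v 0 i)%:~R * l i.
  rewrite {1}[v]row_sum_delta -[lam]/(lamA : _ -> _) raddf_sum; apply: eq_bigr => i _.
  by rewrite -[v 0 i]intz scaler_int raddfMz /= /l intz mulrzl.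
move=> e e0.
(* With mesh [h = |y| / (K + 1)], [C * h] adds up three errors: moving from [y] to a mesh point, the
   difference quotient there, and the linear part. The choice of [K] makes it at most [e * |y|]. *)
pose C := `|L| + \sum_i `|l i| + 1.
have S0 : 0 <= \sum_i `|l i| by exact: sumr_ge0.
have C0 : 0 < C by rewrite /C ltr_wpDl// addr_ge0.
have [K KC] := small_inv (divr_gt0 e0 C0).
pose vec (t : {ffun 'I_n -> 'I_(2 * K.+1).+1}) : 'rV[int]_n :=
  \row_i ((t i)%:Z - K.+1%:Z).
(* There are finitely many vectors [vec t], with entries between [-(K + 1)] and [K + 1], so one [d]
   serves them all. *)
have : \forall h \near 0^'+, forall t, `|f (x + h *: intv (vec t)) - f x - h * lam (vec t)| <= h.
  apply: filter_forall => t; have [d d0 td] := lamP (vec t) _ ltr01.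
  near=> h; have h0 : 0 < h by [].
  have := td h; rewrite mul1r gtr0_norm//; apply.
  by near: h; exact: nbhs_right_lt.
rewrite near_withinE => /nbhs_ballP[d /= d0 dh].
exists d => // y yd; have [->|y0] := eqVneq y 0.
  rewrite addr0 subrr big1 ?subrr ?normr0 ?mulr0// => i _.
  by rewrite mxE mul0r.
set rho := `|y| in yd *.
have rho0 : 0 < rho by rewrite normr_gt0.
pose h := rho * K.+1%:R^-1.
have h0 : 0 < h by rewrite mulr_gt0.
have hd : h < d.
  by rewrite (le_lt_trans _ yd)// ler_piMr ?(ltW rho0)// invf_le1// ler1n.
have hK : h * K.+1%:R = rho by rewrite /h mulfVK.
(* The shift by [K + 1] makes [w i] nonnegative, so that truncation is its integer part. *)
pose w i := y 0 i / h + K.+1%:R.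
have yw i : h * (w i - K.+1%:R) = y 0 i by rewrite /w addrK mulrC divfK// gt_eqF.
have wK i : 0 <= w i <= (2 * K.+1)%:R.
  have : `|h * (w i - K.+1%:R)| <= h * K.+1%:R by rewrite yw hK rV_coord_le.
  rewrite normrM gtr0_norm// ler_pM2l// ler_norml natrM => /andP[w1 w2].
  by apply/andP; split; move: w1 w2; set j := K.+1%:R; lra.
have w0 i : 0 <= w i by case/andP: (wK i).
pose t := [ffun i => inord (Num.trunc (w i)) : 'I_(2 * K.+1).+1].
have tw i : (t i)%:R <= w i < (t i).+1%:R.
  have /andP[tr1 tr2] := truncn_itv (w0 i).
  rewrite ffunE inordK; first by rewrite tr1 tr2.
  by rewrite ltnS -(ler_nat R) (le_trans tr1)//; case/andP: (wK i).
have vE i : intv (vec t) 0 i = (t i)%:R - K.+1%:R.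
  by rewrite !mxE rmorphB /= -!pmulrn.
have yv i : `|y 0 i - h * intv (vec t) 0 i| <= h.
  rewrite vE -yw -mulrBr normrM gtr0_norm// ler_piMr ?(ltW h0)//.
  have -> : w i - K.+1%:R - ((t i)%:R - K.+1%:R) = w i - (t i)%:R by ring.
  have /andP[t1 t2] := tw i; rewrite ger0_norm ?subr_ge0//.
  by rewrite lerBlDl -natr1 in t2 *; rewrite -[_ + 1]/(_ + 1) ltW.
have -> : f (x + y) - f x - \sum_i y 0 i * l i =
   (f (x + y) - f (x + h *: intv (vec t))) +
   (f (x + h *: intv (vec t)) - f x - h * lam (vec t)) -
   \sum_i (y 0 i - h * intv (vec t) 0 i) * l i.
  have -> : \sum_i (y 0 i - h * intv (vec t) 0 i) * l i = \sum_i y 0 i * l i - h * lam (vec t).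
    rewrite lamE mulr_sumr -sumrB; apply: eq_bigr => i _.
    by rewrite [intv _ 0 i]mxE mulrBl mulrA.
  ring.
rewrite (le_trans (ler_normB _ _))// (le_trans (lerD (ler_normD _ _) (lexx _)))//.
have b1 : `|f (x + y) - f (x + h *: intv (vec t))| <= `|L| * h.
  rewrite (le_trans (fL _ _))// (le_trans (ler_wpM2r _ (ler_norm L)))//.
  rewrite ler_wpM2l// opprD addrACA subrr add0r.
  by apply: rV_norm_le; [exact: ltW|move=> i; rewrite 2!mxE mxE; exact: yv].
have b2 : `|f (x + h *: intv (vec t)) - f x - h * lam (vec t)| <= h.
  by apply: dh => //; rewrite /ball/= sub0r normrN gtr0_norm.
have b3 : `|\sum_i (y 0 i - h * intv (vec t) 0 i) * l i| <= (\sum_i `|l i|) * h.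
  rewrite mulr_suml (le_trans (ler_norm_sum _ _ _))//; apply: ler_sum => i _.
  by rewrite normrM mulrC ler_wpM2l.
rewrite (le_trans (lerD (lerD b1 b2) b3))//.
have -> : `|L| * h + h + (\sum_i `|l i|) * h = C * h by rewrite /C; ring.
rewrite /h mulrA [C * _]mulrC -mulrA mulrC ler_pM2r//.
by rewrite mulrC -ler_pdivlMr// ltW.
Unshelve. all: by end_near. Qed.

End Rademacher.

(** * From diagonal Jacobian entries to coordinate slopes *)

Section CoordinateSlope.
Variables (R : realType) (n : nat).
Local Notation mu := (@lebesgue_measure R).
Local Notation V := 'rV[R]_n.

Lemma mulmxr_continuous (M : 'M[R]_n) : continuous (mulmxr M : V -> V).
Proof.
apply: (@lip_continuous _ _ _ _ (\sum_j \sum_i `|M i j|)) => x y.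
rewrite -[_ - _]/(x *m M - y *m M) -mulmxBl.
apply: rV_norm_le => [|j].
  by rewrite mulr_ge0// sumr_ge0// => j _; exact: sumr_ge0.
rewrite mxE (le_trans (ler_norm_sum _ _ _))//.
rewrite [X in _ <= X * _](bigD1 j)//= mulrDl -[leLHS]addr0 lerD//.
  rewrite mulr_suml; apply: ler_sum => i _; rewrite normrM mulrC ler_wpM2l//.
  exact: rV_coord_le.
by rewrite mulr_ge0// sumr_ge0// => k _; exact: sumr_ge0.
Qed.

Lemma differentiable_expansion (F : V -> V) (M : 'M[R]_n) (x : V) :
  (forall e, 0 < e -> \forall y \near (0 : V), `|F (x + y) - F x - y *m M| <= e * `|y|) ->
  differentiable F x /\ jacobian F x = M.
Proof.
move=> FM.
pose df : {linear V -> V} := mulmxr M.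
have Fo : (F \o shift x : V -> V) = cst (F x) + (df : V -> V) +o_ (0 : V) (id : V -> V).
  apply/(@eqaddoP R V V V) => e e0; have := FM e e0; apply: filterS => y.
  by have -> : F (x + y) - F x - y *m M = F (y + x) - (F x + y *m M) by rewrite opprD addrA [y + x]addrC.
have dF := @diff_unique R V V F df x (@mulmxr_continuous M) Fo.
split.
  by apply/diff_locallyP; rewrite dF; split => //; exact: mulmxr_continuous.
apply/matrixP => i j; rewrite mxE dF /= -rowE mxE //.
Qed.

Lemma rademacher_coordinate (F : V -> V) (L D : R) (i : 'I_n) :
  (forall x y, `|F x - F y| <= L * `|x - y|) ->
  (forall x, differentiable F x -> jacobian F x i i <= D) ->
  forall x t, 0 <= t -> F (x + t *: delta_mx 0 i) 0 i - F x 0 i <= D * t.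
Proof.
move=> FL FD x t t0.
have [Nul [NulU NulL NulX]] := null_ideal_ex R n.
pose f j x := F x 0 j.
have fL j y z : `|f j y - f j z| <= L * `|y - z|.
  by rewrite (le_trans _ (FL y z))// (le_trans _ (rV_coord_le _ j))// !mxE.
(* All components are needed: the bound [D] on entry [i] is available only where the whole map [F]
   is differentiable. *)
pose E := \bigcup_j exceptional (f j).
have NE : Nul E.
  by apply: (Nul_countable NulU NulL) => j; apply: (Nul_exceptional NulU NulL (fL j)).
pose ei : V := delta_mx 0 i.
have slope y0 s : ~ E (y0 + s *: ei) -> derive1 (fun s => f i (y0 + s *: ei)) s <= D.
  move: (erefl (y0 + s *: ei)); move: {-2}(y0 + s *: ei) => y yE nE.
  have /choice[l lP] j : exists l : 'I_n -> R, forall e, 0 < e -> exists2 d, 0 < d &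
    forall z, `|z| < d -> `|f j (y + z) - f j y - \sum_k z 0 k * l k| <= e * `|z|.
    by apply: (not_exceptional (fL j)) => Ej; apply: nE; exists j.
  (* Row vectors multiply [M] from the left, hence the transposed indices: row [a] is the direction,
     column [b] the component. *)
  pose M := \matrix_(a, b) l b a.
  have FM e : 0 < e -> \forall z \near (0 : V), `|F (y + z) - F y - z *m M| <= e * `|z|.
    move=> e0.
    have : \forall z \near (0 : V), forall j, `|f j (y + z) - f j y - \sum_k z 0 k * l j k| <= e * `|z|.
      apply: (filter_forall (F := nbhs (0 : V))) => j; have [d d0 dP] := lP j e e0.
      by apply/(@nbhs_normP R V); exists d => // z /=; rewrite sub0r normrN; exact: dP.
    apply: filterS => z zP; apply: rV_norm_le => [|j].
      by rewrite mulr_ge0// ltW.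
    rewrite (le_trans _ (zP j))// !mxE /f.
    by under [X in _ <= `|_ - X|]eq_bigr do rewrite -[l j _](mxE matrix_key (fun a b => l b a)).
  have [dF jF] := differentiable_expansion FM.
  have := FD _ dF; rewrite jF mxE; apply: le_trans.
  rewrite le_eqVlt; apply/orP; left; apply/eqP.
  apply: (cvg_lim (@Rhausdorff R)); apply/(@cvgrPdist_le R R^o) => e e0.
  have [d d0 dP] := lP i e e0.
  have ei1 : `|ei| <= 1.
    by apply: rV_norm_le => // j; rewrite mxE eqxx /=; case: eqP; rewrite ?normr1 ?normr0.
  near=> h.
  have h0 : h != 0 by near: h; exact: nbhs_dnbhs_neq.
  have hd : `|h| < d by near: h; exact: dnbhs0_lt.
  have hei : `|h *: ei| <= `|h| by rewrite normrZ ler_piMr.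
  have := dP _ (le_lt_trans hei hd).
  rewrite (bigD1 i)//= big1 ?addr0; last first.
    by move=> j ji; rewrite !mxE eqxx (negbTE ji) mulr0 mul0r.
  rewrite !mxE !eqxx mulr1 => dPh.
  rewrite [h + s]addrC scalerDl addrA -yE.
  rewrite distrC -(@ler_pM2r _ `|h|) ?normr_gt0// -normrM mulrBl.
  rewrite [_ *: _ * h]mulrC mulrA divff// mul1r [l i i * h]mulrC (le_trans dPh)//.
  by rewrite ler_wpM2l// ltW.
(* The line through [x] may lie inside [E]. Some parallel line through a point [y] within [r] of [x]
   meets [E] in a null set, and moving both ends costs [2 * |L| * r]. *)
have loc (r : R) : 0 < r -> F (x + t *: ei) 0 i - F x 0 i <= D * t + 2 * `|L| * r.
  move=> r0; have [y [xy yE]] := NulX _ ei x _ r0 NE.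
  pose g s := f i (y + s *: ei).
  have gL s s' : `|g s - g s'| <= L * `|ei| * `|s - s'|.
    rewrite (le_trans (fL _ _ _))// -mulrA [`|ei| * _]mulrC -normrZ.
    by rewrite opprD addrACA subrr add0r -scalerBl.
  have : g t - g 0 <= D * (t - 0).
    apply: (lip_ae_derive_le t0 gL); move: yE.
    apply: (@filterS _ _ (ae_filter_ringOfSetsType mu)) => s sE _ _.
    exact: slope.
  rewrite subr0 /g scale0r addr0.
  have xyr : `|x - y| <= r by apply: rV_norm_le => [|j]; rewrite ?mxE ?ltW// mxE ltW.
  have h1 : `|f i (x + t *: ei) - f i (y + t *: ei)| <= `|L| * r.
    rewrite (le_trans (fL _ _ _))// opprD addrACA subrr addr0.
    by rewrite (le_trans (ler_wpM2r _ (ler_norm L)))// ler_wpM2l.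
  have h2 : `|f i x - f i y| <= `|L| * r.
    rewrite (le_trans (fL _ _ _))//.
    by rewrite (le_trans (ler_wpM2r _ (ler_norm L)))// ler_wpM2l.
  move: h1 h2; rewrite /f !ler_norml => /andP[h1 h2] /andP[h3 h4] h5; lra.
apply/ler_addgt0Pr => e e0.
have L1 : 0 < 2 * `|L| + 1 by rewrite ltr_wpDl// mulr_ge0.
rewrite (le_trans (loc _ (divr_gt0 e0 L1)))// lerD2l mulrCA ger_pMr//.
by rewrite ler_pdivrMr// mul1r lerDl.
Unshelve. all: by end_near. Qed.

End CoordinateSlope.

(** * Accretive maps and averaged iterations *)

Section AbstractNorm.
Variables (R : realType) (n : nat).
Local Notation V := 'rV[R]_n.
Variables (N : V -> R) (lo up : R).
Hypothesis ND : forall x y, N (x + y) <= N x + N y.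
Hypothesis NZ : forall a x, N (a *: x) = `|a| * N x.
Hypothesis lo0 : 0 < lo.
Hypothesis Nlo : forall x, lo * `|x| <= N x.
Hypothesis up0 : 0 < up.
Hypothesis Nup : forall x, N x <= up * `|x|.

Lemma N_ge0 x : 0 <= N x.
Proof. by rewrite (le_trans _ (Nlo x))// mulr_ge0// ltW. Qed.

Lemma N_0 : N 0 = 0.
Proof. by rewrite -(scale0r (0 : V)) NZ normr0 mul0r. Qed.

Lemma N_opp x : N (- x) = N x.
Proof. by rewrite -scaleN1r NZ normrN1 mul1r. Qed.

Lemma N_dist x y : N (x - y) = N (y - x).
Proof. by rewrite -N_opp opprB. Qed.

Lemma N_eq0 x : N x <= 0 -> x = 0.
Proof.
move=> x0; apply/eqP; rewrite -normr_le0 -(@pmulr_rle0 _ lo)//.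
exact: le_trans (Nlo x) x0.
Qed.

Lemma N_sum (I : Type) (r : seq I) (P : pred I) (f : I -> V) :
  N (\sum_(i <- r | P i) f i) <= \sum_(i <- r | P i) N (f i).
Proof.
elim/big_ind2 : _ => //; first by rewrite N_0.
by move=> x1 x2 y1 y2 h1 h2; rewrite (le_trans (ND _ _))// lerD.
Qed.

Lemma N_lipschitz x y : `|N x - N y| <= up * `|x - y|.
Proof.
rewrite ler_norml; apply/andP; split.
  have := ND (y - x) x; rewrite subrK => h1.
  have := Nup (y - x); rewrite distrC => h2; lra.
have := ND (x - y) y; rewrite subrK => h1.
have h2 := Nup (x - y); lra.
Qed.

Lemma N_continuous : continuous N.
Proof. exact: (@lip_continuous R V R^o N up N_lipschitz). Qed.

Lemma N_ball_compact r : compact [set x | N x <= r].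
Proof.
apply: bounded_closed_compact.
  exists (r / lo); split; first exact: num_real.
  move=> M rM x /= xr; rewrite ltW// (le_lt_trans _ rM)// ler_pdivlMr// mulrC.
  exact: le_trans xr.
have := (continuous_closedP _).1 N_continuous _ (@closed_le R r).
exact.
Qed.

Lemma compact_seq_cluster (A : set V) (u : nat -> V) : compact A -> (forall k, A (u k)) ->
  exists p, A p /\ forall e K, 0 < e -> exists k, (K <= k)%N /\ N (u k - p) <= e.
Proof.
move=> cA uA; have uAoo : (u @ \oo) A by exists 0%N => // k _; exact: uA.
have [p [Ap pu]] := cA (u @ \oo) _ uAoo.
exists p; split => // e K e0.
have d0 : 0 < e / up by rewrite divr_gt0.
have [|k [/= Kk kp]] := pu [set x | exists2 k, (K <= k)%N & x = u k] (ball p (e / up)) _ (nbhsx_ballx p _ d0).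
  by exists K => // k /= Kk; exists k.
case: Kk kp => k' Kk' -> kp; exists k'; split => //.
rewrite (le_trans (Nup _))// -ler_pdivlMl// mulrC ltW//.
by move: kp; rewrite -ball_normE /= distrC.
Qed.

Lemma continuous_N (H : V -> V) : continuous H -> forall p e, 0 < e ->
  exists2 d, 0 < d & forall z, N (z - p) <= d -> N (H z - H p) <= e.
Proof.
move=> cH p e e0; have /(@cvgrPdist_le R V) /(_ _ (divr_gt0 e0 up0)) := cH p.
move=> /(@nbhs_normP R V)[d /= d0 dH]; exists (d * lo / 2); first by rewrite divr_gt0 ?mulr_gt0.
move=> z zp; rewrite (le_trans (Nup _))// -ler_pdivlMl// mulrC distrC.
apply: dH => /=; rewrite distrC -(@ltr_pM2l _ lo)// (le_lt_trans (Nlo _))//.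
rewrite (le_lt_trans zp)// [lo * d]mulrC ltr_pdivrMr// ltr_pMr ?ltr1n//.
by rewrite mulr_gt0.
Qed.

Lemma unif_continuous_N (H : V -> V) r e : continuous H -> 0 < e ->
  exists2 d, 0 < d & forall x y, N x <= r -> N y <= r -> N (x - y) <= d -> N (H x - H y) <= e.
Proof.
move=> cH e0; apply: contrapT => /forall2NP h.
have hk k : exists xy : V * V, [/\ N xy.1 <= r, N xy.2 <= r, N (xy.1 - xy.2) <= k.+1%:R^-1 &
    e < N (H xy.1 - H xy.2)].
  apply: contrapT => /forallNP hk.
  have [|] := h (k.+1%:R^-1); first by rewrite invr_gt0 ltr0n.
  apply => x y xr yr xy; rewrite leNgt; apply/negP => exy.
  by apply: (hk (x, y)).
have /choice[u uP] := hk.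
have [p [pr pu]] := @compact_seq_cluster _ (fun k => (u k).1) (@N_ball_compact r)
  (fun k => let: And4 a _ _ _ := uP k in a).
have [d d0 dH] := continuous_N cH p (divr_gt0 e0 (ltr0n R 2)).
have [K Kd] := small_inv (divr_gt0 d0 (ltr0n R 2)).
have [k [Kk /= kp]] := pu (d / 2) K (divr_gt0 d0 (ltr0n R 2)).
have [xr yr xy] := uP k; apply/negP; rewrite -leNgt.
have kK : k.+1%:R^-1 <= K.+1%:R^-1 :> R by rewrite lef_pV2 ?posrE// ler_nat ltnS.
have h1 : N (H (u k).1 - H p) <= e / 2 by apply: dH; rewrite (le_trans kp)// ler_pdivrMr// ler_peMr ?ltW// ltr1n.
have h2 : N (H (u k).2 - H p) <= e / 2.
  apply: dH; have := ND ((u k).2 - (u k).1) ((u k).1 - p).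
  rewrite addrA subrK [N (_ - (u k).1)]N_dist; move: xy kK Kd kp d0.
  set i := _^-1; set j := _^-1; lra.
have := ND (H (u k).1 - H p) (H p - H (u k).2).
rewrite addrA subrK [N (H p - _)]N_dist; lra.
Qed.

Lemma N_cvg (u : nat -> V) p :
  (forall e, 0 < e -> exists K, forall k, (K <= k)%N -> N (u k - p) <= e) ->
  u @ \oo --> p.
Proof.
move=> uP; apply/(@cvgrPdist_le R V) => e e0.
have [K KP] := uP _ (mulr_gt0 lo0 e0).
exists K => // k /= Kk; rewrite distrC -(@ler_pM2l _ lo)//.
exact: le_trans (Nlo _) (KP k Kk).
Qed.

Lemma geometric_le (q a e : R) : 0 <= q < 1 -> 0 < e ->
  exists K, forall k, (K <= k)%N -> a * q ^+ k <= e.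
Proof.
move=> /andP[q0 q1] e0.
have /(@cvgrPdist_le R R^o) /(_ e e0) [K _ KP] : geometric a q @ \oo --> (0 : R).
  by apply: cvg_geometric; rewrite ger0_norm.
exists K => k /= /KP; rewrite sub0r normrN; apply: le_trans; exact: ler_norm.
Qed.

(** In other words, for [c >= 0], [(Id + h H)^-1] is Lipschitz with constant [1 / (1 + h c)] where
    it is defined. This form involves the norm alone and no weak pairing. *)
Definition accretive (H : V -> V) (c : R) := forall h x y, 0 <= h ->
  (1 + h * c) * N (x - y) <= N (x - y + h *: (H x - H y)).

(* Explicit Euler for x' = - P x: uniform continuity controls the error of one
   step, strong accretivity makes any two trajectories merge, so x_k and x_(k+m)
   are eventually close for all m; averaging the increments P x_(k+j) over a long
   window then shows that P x_k is small. *)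
Lemma accretive_approx_zero (P : V -> V) c : continuous P -> 0 < c -> accretive P c ->
  exists r, forall e, 0 < e -> exists2 x, N x <= r & N (P x) <= e.
Proof.
(* Compared with 0, implicit steps would stay within [N (P 0) / c]; the additional 1 absorbs the
   step errors, which are at most [h * c]. *)
move=> cP c0 accP; pose r := N (P 0) / c + 1.
have r0 : 0 < r by rewrite ltr_wpDl// divr_ge0// ?N_ge0 // ltW.
have cr : c * r = N (P 0) + c by rewrite /r mulrDr mulr1 mulrC divfK// gt_eqF.
have [M M0 PM] : exists2 M, 0 < M & forall x, N x <= r -> N (P x) <= M.
  have [||z _ zP] := @EVT_max_rV R n (fun x => N (P x)) [set x | N x <= r] _ (@N_ball_compact r).
  - by exists 0; rewrite /= N_0 ltW.
  - apply: continuous_subspaceT => x; apply: (@continuous_comp _ _ _ P N); first exact: cP.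
    exact: N_continuous.
  exists (N (P z) + 1); first by rewrite ltr_wpDl// N_ge0.
  by move=> x xr; rewrite (le_trans (zP x _)) ?lerDl// inE.
exists r => e e0.
have r10 : 0 <= r + 1 by rewrite addr_ge0// ltW.
have [d1 d10 d1P] := unif_continuous_N (r + 1) cP (divr_gt0 e0 (ltr0n R 2)).
(* The bound [c] keeps the trajectory in the ball of radius [r]. The other one makes
   [3 * (ep / c) <= d1]: two parts for the accumulated step errors, one for the geometric tail. *)
pose ep := Num.min c (c * d1 / 3).
have ep0 : 0 < ep by rewrite lt_min c0 divr_gt0// mulr_gt0.
have epc : ep <= c by rewrite ge_min lexx.
have ep3 : 3 * (ep / c) <= d1.
  rewrite mulrA ler_pdivrMr// mulrC -ler_pdivlMr// [d1 * c]mulrC.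
  by rewrite ge_min lexx orbT.
have [d2 d20 d2P] := unif_continuous_N (r + 1) cP ep0.
(* A step has length at most [h * M]: below [d2] it changes [P] by at most [ep], below 1 it stays in
   the ball of radius [r + 1]. *)
pose h := Num.min (d2 / M) (M^-1).
have h0 : 0 < h by rewrite lt_min divr_gt0// invr_gt0.
have hM2 : h * M <= d2 by rewrite -ler_pdivlMr// ge_min lexx.
have hM1 : h * M <= 1 by rewrite -ler_pdivlMr// div1r ge_min lexx orbT.
pose x k := iter k (fun x => x - h *: P x) 0.
have xS k : x k.+1 = x k - h *: P (x k) by [].
have dx k : N (x k) <= r -> N (x k.+1 - x k) <= h * M.
  move=> xr; rewrite xS addrAC subrr add0r N_opp NZ gtr0_norm// ler_wpM2l ?(ltW h0)//.
  exact: PM.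
have x1 k : N (x k) <= r -> N (x k.+1) <= r + 1.
  move=> xr; have := ND (x k) (x k.+1 - x k); rewrite addrCA subrr addr0.
  have := dx k xr; lra.
have dP k : N (x k) <= r -> N (P (x k.+1) - P (x k)) <= ep.
  move=> xr; apply: d2P; [exact: x1|lra|exact: le_trans (dx k xr) hM2].
have hc0 : 0 < 1 + h * c by rewrite addr_gt0// mulr_gt0.
have xr k : N (x k) <= r.
  elim: k => [|k IH]; first by rewrite /x /= N_0 ltW.
  (* Accretivity contracts implicit steps, and an explicit step is implicit up to an error: with [y]
     the successor of [x], [y + h P y = x + h (P y - P x)]. *)
  have := accP h (x k.+1) 0 (ltW h0); rewrite !subr0.
  have -> : x k.+1 + h *: (P (x k.+1) - P 0) = x k + h *: (P (x k.+1) - P (x k)) - h *: P 0.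
    by rewrite xS; apply/rowP => i; rewrite !mxE; ring.
  move=> H1; have := le_trans H1 (ND _ _); have := ND (x k) (h *: (P (x k.+1) - P (x k))).
  rewrite N_opp !NZ gtr0_norm// => H2 H3.
  have H4 : h * N (P (x k.+1) - P (x k)) <= h * ep by rewrite ler_wpM2l ?(ltW h0)// dP.
  have H5 : h * ep <= h * c by rewrite ler_wpM2l ?(ltW h0).
  rewrite -(@ler_pM2l _ (1 + h * c))// (le_trans (le_trans H1 (ND _ _)))//.
  rewrite N_opp NZ gtr0_norm// mulrDl mul1r -mulrA cr mulrDr; lra.
pose q := (1 + h * c)^-1.
have q0 : 0 < q by rewrite invr_gt0.
have q1 : q < 1 by rewrite invf_lt1// ltrDl mulr_gt0.
have qhc : q * (1 + h * c) = 1 by rewrite mulVf// gt_eqF.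
have merge m k : N (x (k + m)%N - x k) <= 2 * (ep / c) + 2 * r * q ^+ k.
  elim: k => [|k IH].
    rewrite add0n mulr1 (le_trans (ND _ _))// N_opp.
    have := xr m; have := xr 0%N; have : 0 < ep / c by rewrite divr_gt0.
    lra.
  have := accP h (x (k.+1 + m)%N) (x k.+1) (ltW h0).
  have -> : x (k.+1 + m)%N - x k.+1 + h *: (P (x (k.+1 + m)%N) - P (x k.+1)) =
    x (k + m)%N - x k + (h *: (P (x (k + m).+1) - P (x (k + m)%N)) - h *: (P (x k.+1) - P (x k))).
    rewrite addSn !xS !scalerBr; move: (x (k + m)%N) (x k) => u w.
    move: (h *: P u) (h *: P w) (h *: P (u - _)) (h *: P (w - _)) => a b a' b'.
    by apply/rowP => i; rewrite !mxE; ring.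
  move=> H1; have := le_trans (le_trans H1 (ND _ _)) (lerD IH (ND _ _)).
  rewrite N_opp !NZ gtr0_norm// => H2.
  have H3 : h * N (P (x (k + m).+1) - P (x (k + m)%N)) <= h * ep by rewrite ler_wpM2l ?(ltW h0)// dP.
  have H4 : h * N (P (x k.+1) - P (x k)) <= h * ep by rewrite ler_wpM2l ?(ltW h0)// dP.
  rewrite -(@ler_pM2l _ (1 + h * c))// (le_trans H2)//.
  have -> : (1 + h * c) * (2 * (ep / c) + 2 * r * q ^+ k.+1) =
      2 * (ep / c) + 2 * (h * ep) + 2 * r * q ^+ k.
    have -> : 2 * r * q ^+ k = (q * (1 + h * c)) * (2 * r * q ^+ k) by rewrite qhc mul1r.
    by rewrite exprS; field; rewrite gt_eqF.
  lra.
have [|k /(_ k (leqnn k)) kP] := @geometric_le q (2 * r) (ep / c) _ (divr_gt0 ep0 c0).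
  by rewrite q1 ltW.
have close m : N (x (k + m)%N - x k) <= d1.
  have := merge m k; lra.
have avg m : h *: \sum_(j < m) P (x (k + j)%N) = x k - x (k + m)%N.
  elim: m => [|m IH]; first by rewrite big_ord0 scaler0 addn0 subrr.
  by rewrite big_ord_recr /= scalerDr IH addnS xS opprB addrA addrAC.
exists (x k) => //.
(* The displacement over the window is at most [d1]; this length makes its share [d1 / (m h)] in the
   bound on [P (x k)] at most [e / 2]. *)
pose m := (Num.bound (2 * d1 / (h * e))).+1.
have mP : d1 <= m%:R * h * (e / 2).
  have : 2 * d1 / (h * e) < m%:R.
    rewrite (lt_trans (archi_boundP _)) ?ltr_nat//.
    by rewrite divr_ge0// ?mulr_ge0// ltW.
  rewrite ltr_pdivrMr ?mulr_gt0// => ?; lra.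
have mh0 : 0 < m%:R * h by rewrite mulr_gt0.
rewrite -(@ler_pM2l _ (m%:R * h))//.
have -> : m%:R * h * N (P (x k)) = N (x k - x (k + m)%N - h *: \sum_(j < m) (P (x (k + j)%N) - P (x k))).
  rewrite -avg -scalerBr -sumrB.
  under eq_bigr do rewrite opprB addrCA subrr addr0.
  by rewrite sumr_const card_ord -[_ (x k) *+ m]scaler_nat scalerA NZ gtr0_norm ?mulr_gt0// [h * _]mulrC.
rewrite (le_trans (ND _ _))// N_opp N_dist NZ gtr0_norm//.
have : N (\sum_(j < m) (P (x (k + j)%N) - P (x k))) <= m%:R * (e / 2).
  rewrite (le_trans (N_sum _ _ _))// mulr_natl -[X in _ *+ X]card_ord -sumr_const.
  apply: ler_sum => j _; apply: d1P; last exact: close.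
    by rewrite (le_trans (xr _))// lerDl.
  by rewrite (le_trans (xr _))// lerDl.
rewrite -(@ler_pM2l _ h)// => H1.
have := close m; lra.
Qed.

(** The approximate zeros of [H - b] lie in one ball, whatever the tolerance; compactness provides a
    minimizer of [N (H x - b)] there, and the minimum is 0. *)
Lemma accretive_surj (H : V -> V) c b : continuous H -> 0 < c -> accretive H c ->
  exists x, H x = b.
Proof.
move=> cH c0 accH; pose P x := H x - b.
have PB x y : P x - P y = H x - H y by rewrite /P opprB addrA subrK.
have cP : continuous P.
  move=> x; apply: (@continuous_comp _ _ _ H (fun y => y - b)); first exact: cH.
  by apply: (@lip_continuous R V V _ 1) => u v; rewrite opprB addrA subrK mul1r.
have accP : accretive P c by move=> h x y h0; rewrite PB; exact: accH.
have [r rP] := accretive_approx_zero cP c0 accP.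
have [x1 x1r _] := rP 1 ltr01.
have [||z zr zP] := @EVT_min_rV R n (fun x => N (P x)) [set x | N x <= r] _ (@N_ball_compact r).
- by exists x1.
- apply: continuous_subspaceT => x; apply: (@continuous_comp _ _ _ P N); first exact: cP.
  exact: N_continuous.
exists z; apply/eqP; rewrite -subr_eq0; apply/eqP/N_eq0.
apply/ler_addgt0Pr => e e0; rewrite add0r.
have [x xr xe] := rP e e0; rewrite (le_trans _ xe)//.
by apply: zP; rewrite inE.
Qed.

(** * Krasnoselskii-Mann iteration with weight 1/2 *)

Section KrasnoselskiiMann.
Variables (T : V -> V) (x : nat -> V) (z : V).
Hypothesis TN : forall u v, N (T u - T v) <= N (u - v).
Hypothesis xS : forall k, x k.+1 = 2^-1 *: x k + 2^-1 *: T (x k).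
Hypothesis Tz : T z = z.

Let d k := N (x k - T (x k)).

Lemma km_fejer w : T w = w -> forall k, N (x k.+1 - w) <= N (x k - w).
Proof.
move=> Tw k.
have -> : x k.+1 - w = 2^-1 *: (x k - w) + 2^-1 *: (T (x k) - T w).
  rewrite xS Tw; apply/rowP => i; rewrite !mxE; lra.
rewrite (le_trans (ND _ _))// !NZ gtr0_norm ?invr_gt0//.
have := TN (x k) w; lra.
Qed.

Lemma km_fejer_le w k j : T w = w -> (k <= j)%N -> N (x j - w) <= N (x k - w).
Proof.
move=> Tw /subnK <-; elim: (j - k)%N => // i IH.
by rewrite addSn (le_trans (km_fejer Tw _)).
Qed.

Lemma km_step k : N (x k.+1 - x k) = d k / 2.
Proof.
have -> : x k.+1 - x k = - (2^-1 *: (x k - T (x k))).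
  rewrite xS; apply/rowP => i; rewrite !mxE; lra.
by rewrite N_opp NZ gtr0_norm ?invr_gt0// mulrC.
Qed.

Lemma km_dS k : d k.+1 <= d k.
Proof.
have -> : d k = d k / 2 + N (x k.+1 - x k) by rewrite km_step -splitr.
have h1 : N (x k.+1 - T (x k)) = d k / 2.
  have -> : x k.+1 - T (x k) = 2^-1 *: (x k - T (x k)).
    rewrite xS; apply/rowP => i; rewrite !mxE; lra.
  by rewrite NZ gtr0_norm ?invr_gt0// mulrC.
have := ND (x k.+1 - T (x k)) (T (x k) - T (x k.+1)).
rewrite addrA subrK h1 /d => h2; have := TN (x k) (x k.+1).
rewrite [N (x k - _)]N_dist; lra.
Qed.

Lemma km_d_le k j : (k <= j)%N -> d j <= d k.
Proof.
by move=> /subnK <-; elim: (j - k)%N => // i IH; rewrite addSn (le_trans (km_dS _)).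
Qed.

Lemma km_drift i m : N (x (i + m)%N - x i) <= m%:R / 2 * d i.
Proof.
elim: m => [|m IH]; first by rewrite addn0 subrr N_0 !mul0r.
have := ND (x (i + m.+1)%N - x (i + m)%N) (x (i + m)%N - x i).
rewrite addrA subrK addnS km_step => h.
have e1 : m.+1%:R = m%:R + 1 :> R by rewrite natr1.
have := @km_d_le i (i + m)%N (leq_addr _ _); rewrite e1; lra.
Qed.

(** The Goebel-Kirk inequality: while the residual [d] is nearly constant, [T (x (i + m))] is at
    distance about [(1 + m / 2) * d i] from [x i], as if the iterates followed a straight line. The
    induction on [m] goes from [i + 1] to [i], using that [x (i + 1)] is the midpoint of [x i] and
    [T (x i)]. *)
Lemma goebel_kirk m i :
  (1 + m%:R / 2) * d i <= N (T (x (i + m)%N) - x i) + 2 ^+ m * (d i - d (i + m)%N).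
Proof.
elim: m i => [|m IH] i.
  by rewrite addn0 mul0r addr0 !mul1r subrr addr0 /d N_dist.
have h1 := IH i.+1; rewrite addSnnS in h1.
have h2 : N (T (x (i + m.+1)%N) - x i.+1) <=
    2^-1 * N (T (x (i + m.+1)%N) - x i) + 2^-1 * ((m.+1%:R / 2) * d i).
  have -> : T (x (i + m.+1)%N) - x i.+1 =
     2^-1 *: (T (x (i + m.+1)%N) - x i) + 2^-1 *: (T (x (i + m.+1)%N) - T (x i)).
    rewrite xS; apply/rowP => i0; rewrite !mxE; lra.
  rewrite (le_trans (ND _ _))// !NZ gtr0_norm ?invr_gt0// lerD2l ler_wpM2l ?invr_ge0//.
  exact: le_trans (TN _ _) (km_drift _ _).
have h3 := km_dS i.
(* The coefficient [m + 2 - 2^(m + 1)] of [d i.+1] is nonpositive, so [d i.+1] may be replaced by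
   the larger [d i]. *)
have h4 : (m.+2%:R : R) <= 2 ^+ m.+1.
  by rewrite -natrX ler_nat ltn_expl.
have h5 : (2 ^+ m.+1 - m.+2%:R) * d i.+1 <= (2 ^+ m.+1 - m.+2%:R) * d i.
  by rewrite ler_wpM2l// subr_ge0.
have e1 : m.+1%:R = m%:R + 1 :> R by rewrite natr1.
have e2 : m.+2%:R = m%:R + 2 :> R by rewrite -natrD addn2.
move: h1 h2 h5; rewrite exprS e1 e2; lra.
Qed.

(** Otherwise some [m] satisfies [(1 + m / 2) * e > 2 * rho + 1], whereas [T (x (i + m))] stays
    within [2 * rho] of [x i]. By [goebel_kirk] the residual then drops by more than [2^-m] every
    [m] steps and becomes negative. *)
Lemma km_regular e : 0 < e -> exists k, d k <= e.
Proof.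
move=> e0; apply: contrapT => /forallNP h.
have de k : e < d k by rewrite ltNge; apply/negP; exact: h.
pose rho := N (x 0 - z).
pose m := Num.bound (2 * ((2 * rho + 1) / e)).
have rho0 : 0 <= rho by exact: N_ge0.
have mP : 2 * rho + 1 < (1 + m%:R / 2) * e.
  have : 2 * ((2 * rho + 1) / e) < m%:R.
    apply: archi_boundP; rewrite mulr_ge0// divr_ge0 ?ltW//; lra.
  rewrite mulrA ltr_pdivrMr// => ?; lra.
have [Q Q0 GK] : exists2 Q : R, 0 < Q &
    forall i, (1 + m%:R / 2) * d i <= N (T (x (i + m)%N) - x i) + Q * (d i - d (i + m)%N).
  by exists (2 ^+ m); [rewrite exprn_gt0|exact: goebel_kirk].
have drop i : d (i + m)%N < d i - Q^-1.
  rewrite ltrBrDl -ltrBrDr -(@ltr_pM2l _ Q)// divff ?gt_eqF//.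
  have TxN : N (T (x (i + m)%N) - x i) <= 2 * rho.
    have := ND (T (x (i + m)%N) - T z) (z - x i); rewrite Tz addrA subrK.
    have := TN (x (i + m)%N) z; rewrite Tz [N (z - x i)]N_dist.
    have := @km_fejer_le z 0 i Tz (leq0n _); have := @km_fejer_le z 0 (i + m)%N Tz (leq0n _).
    rewrite -/rho; lra.
  have m0 : 0 <= 1 + m%:R / 2 :> R by rewrite addr_ge0// divr_ge0.
  have := ler_wpM2l m0 (ltW (de i)); have := GK i; move: mP TxN.
  move: (1 + m%:R / 2) => P; lra.
have drops j : d (j * m)%N <= d 0%N - j%:R * Q^-1.
  elim: j => [|j IH]; first by rewrite mul0n mul0r subr0.
  have e1 : j.+1%:R = j%:R + 1 :> R by rewrite natr1.
  have := drop (j * m)%N; rewrite mulSn addnC e1 mulrDl mul1r; move: IH.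
  move: Q^-1 => P; lra.
have : d 0 / Q^-1 < (Num.bound (d 0 / Q^-1))%:R.
  by apply: archi_boundP; rewrite divr_ge0 ?N_ge0// invr_ge0 ltW.
rewrite ltr_pdivrMr ?invr_gt0//; set j := Num.bound _.
have := drops j; have := N_ge0 (x (j * m)%N - T (x (j * m)%N)).
rewrite -/(d _); move: (j%:R * Q^-1) => P; lra.
Qed.

(** A cluster point is fixed because the residuals tend to 0; distances to a fixed point do not
    increase, so the whole sequence converges to it. *)
Lemma km_cvg : exists p, T p = p /\ x @ \oo --> p.
Proof.
have xb k : N (x k) <= N (x 0 - z) + N z.
  have := ND (x k - z) z; rewrite subrK.
  have := @km_fejer_le z 0 k Tz (leq0n _); lra.
have [p [_ pP]] := @compact_seq_cluster _ x (@N_ball_compact _) xb.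
have Tp : T p = p.
  apply/eqP; rewrite -subr_eq0; apply/eqP/N_eq0/ler_addgt0Pr => e e0; rewrite add0r.
  have e30 : 0 < e / 3 by rewrite divr_gt0.
  have [K KP] := km_regular e30; have [k [Kk kp]] := pP _ K e30.
  have := km_d_le Kk; rewrite /d => dk.
  have := ND (T p - T (x k)) (T (x k) - x k); rewrite addrA subrK.
  have := ND (T p - x k) (x k - p); rewrite addrA subrK.
  have := TN p (x k); rewrite [N (p - _)]N_dist [N (T (x k) - _)]N_dist.
  move: dk KP; rewrite /d; lra.
exists p; split => //; apply: N_cvg => e e0.
have [K [_ KP]] := pP e 0%N e0; exists K => k Kk.
exact: le_trans (km_fejer_le Tp Kk) KP.
Qed.

End KrasnoselskiiMann.

End AbstractNorm.

(** * Explicit steps in weighted norms *)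

Section WeightedNorms.
Variables (R : realType) (n : nat) (eta : 'rV[R]_n).
Hypothesis eta0 : forall i, 0 < eta 0 i.
Local Notation V := 'rV[R]_n.
Local Notation N1 := (wnorm WL1 eta).
Local Notation Ninf := (wnorm WLinf eta).

Lemma wnorm1_coord (x : V) i : eta 0 i * `|x 0 i| <= N1 x.
Proof.
rewrite /= (bigD1 i)//= lerDl sumr_ge0// => j _.
by rewrite mulr_ge0// ltW.
Qed.

Lemma wnorminf_le (x : V) r : 0 <= r -> (forall i, `|x 0 i| <= r * eta 0 i) -> Ninf x <= r.
Proof.
move=> r0 xr; apply/bigmax_leP; split => // i _.
by rewrite ler_pdivrMr.
Qed.

Lemma wnorminf_lt (x : V) r : 0 < r -> (forall i, `|x 0 i| < r * eta 0 i) -> Ninf x < r.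
Proof.
move=> r0 xr; apply/bigmax_ltP; split => // i _.
by rewrite ltr_pdivrMr.
Qed.

Lemma wnorminf_coord (x : V) i : `|x 0 i| <= Ninf x * eta 0 i.
Proof. by rewrite -ler_pdivrMr//; exact: (le_bigmax _ (fun i => `|x 0 i| / eta 0 i)). Qed.

Lemma wnorminf_ge0 (x : V) : 0 <= Ninf x.
Proof. by rewrite /=; apply: bigmax_ge_id. Qed.

Lemma wnormD k (x y : V) : wnorm k eta (x + y) <= wnorm k eta x + wnorm k eta y.
Proof.
case: k.
  rewrite /= -big_split /=; apply: ler_sum => i _.
  by rewrite -mulrDr ler_pM2l// mxE ler_normD.
apply: wnorminf_le; first by rewrite addr_ge0// wnorminf_ge0.
by move=> i; rewrite mxE mulrDl (le_trans (ler_normD _ _))// lerD// wnorminf_coord.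
Qed.

Lemma wnormZ k a (x : V) : wnorm k eta (a *: x) = `|a| * wnorm k eta x.
Proof.
have le b (y : V) : Ninf (b *: y) <= `|b| * Ninf y.
  apply: wnorminf_le; first by rewrite mulr_ge0// wnorminf_ge0.
  by move=> i; rewrite mxE normrM -mulrA ler_wpM2l// wnorminf_coord.
case: k.
  by rewrite /= mulr_sumr; apply: eq_bigr => i _; rewrite mxE normrM mulrCA.
have [->|a0] := eqVneq a 0.
  apply/eqP; rewrite eq_le normr0 mul0r wnorminf_ge0 andbT.
  by rewrite (le_trans (le _ _))// normr0 mul0r.
apply/eqP; rewrite eq_le le /= -ler_pdivlMl ?normr_gt0//.
by have := le a^-1 (a *: x); rewrite scalerA mulVf// scale1r normfV.
Qed.

(** One constant dominates all weights and their inverses, so [S^-1] and [S] compare both weighted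
    norms with the sup norm. *)
Let S := 1 + \sum_i eta 0 i + \sum_i (eta 0 i)^-1.

Let S_gt0 : 0 < S.
Proof.
rewrite /S -addrA ltr_pwDl// addr_ge0// sumr_ge0// => i _; first exact: ltW.
by rewrite invr_ge0 ltW.
Qed.

Let eta_le i : eta 0 i <= S.
Proof.
rewrite /S (bigD1 i)//= [1 + _]addrC -!addrA lerDl !addr_ge0// sumr_ge0// => j _; first exact: ltW.
by rewrite invr_ge0 ltW.
Qed.

Let etaV_le i : (eta 0 i)^-1 <= S.
Proof.
rewrite /S [\sum_i _^-1](bigD1 i)//= addrCA lerDl !addr_ge0// sumr_ge0// => j _; first exact: ltW.
by rewrite invr_ge0 ltW.
Qed.

Lemma wnorm_lo k (x : V) : S^-1 * `|x| <= wnorm k eta x.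
Proof.
rewrite ler_pdivrMl//; case: k.
  have N10 : 0 <= N1 x by apply: sumr_ge0 => i _; rewrite mulr_ge0// ltW.
  apply: rV_norm_le => [|i]; first by rewrite mulr_ge0// ltW.
  rewrite (@le_trans _ _ ((eta 0 i)^-1 * N1 x))//.
    by rewrite ler_pdivlMl// wnorm1_coord.
  by rewrite ler_wpM2r.
apply: rV_norm_le => [|i]; first by rewrite mulr_ge0// ?wnorminf_ge0// ltW.
by rewrite (le_trans (wnorminf_coord _ i))// mulrC ler_wpM2r// wnorminf_ge0.
Qed.

Lemma wnorm_up k (x : V) : wnorm k eta x <= S * `|x|.
Proof.
case: k.
  rewrite (@le_trans _ _ (\sum_i eta 0 i * `|x|))//.
    by apply: ler_sum => i _; rewrite ler_pM2l// rV_coord_le.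
  rewrite -mulr_suml ler_wpM2r// /S addrAC lerDr addr_ge0// sumr_ge0// => i _.
  by rewrite invr_ge0 ltW.
apply: wnorminf_le => [|i]; first by rewrite mulr_ge0// ltW.
rewrite (le_trans (rV_coord_le _ i))// mulrAC ler_peMl//.
by rewrite -ler_pdivrMr// div1r.
Qed.

Lemma wnorm_pos : 0 < S^-1 /\ 0 < S.
Proof. by rewrite invr_gt0. Qed.

Section Contraction.
Variables (F : V -> V) (L D c a : R).
Hypothesis FL : forall x y, `|F x - F y| <= L * `|x - y|.
Hypothesis slope : forall i x t, 0 <= t -> F (x + t *: delta_mx 0 i) 0 i - F x 0 i <= D * t.
Hypothesis c0 : 0 <= c.
Hypothesis a0 : 0 < a.
Hypothesis aD : a * D <= 1.

Let step (x : V) := x - a *: F x.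

(** For small [h] the strictly dominant coordinate [i] decides the norm of the perturbed difference,
    so accretivity becomes an inequality on that coordinate. The gap [r - s] tells how small [h]
    must be. *)
Lemma wnorminf_slope (x y : V) i r : accretive Ninf F c -> 0 < r ->
  x 0 i - y 0 i = r * eta 0 i -> 
  (exists2 s, s < r & forall j, j != i -> `|x 0 j - y 0 j| <= s * eta 0 j) ->
  c * (r * eta 0 i) <= F x 0 i - F y 0 i.
Proof.
move=> accF r0 xyi [s0 s0r xys0]; rewrite leNgt; apply/negP => lt.
pose s := Num.max 0 s0.
have s_ge0 : 0 <= s by rewrite le_max lexx.
have sr : s < r by rewrite gt_max r0.
have xys j : j != i -> `|x 0 j - y 0 j| <= s * eta 0 j.
  by move=> ji; rewrite (le_trans (xys0 j ji))// ler_pM2r// le_max lexx orbT.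
pose B := Ninf (F x - F y) + 1.
have B0 : 0 < B by rewrite ltr_wpDl// wnorminf_ge0.
have FB j : `|F x 0 j - F y 0 j| < B * eta 0 j.
  rewrite (@le_lt_trans _ _ (Ninf (F x - F y) * eta 0 j))//.
    by have := wnorminf_coord (F x - F y) j; rewrite !mxE.
  by rewrite ltr_pM2r// ltrDl.
pose h := (r - s) / B.
have h0 : 0 < h by rewrite divr_gt0// subr_gt0.
have hB : h * B = r - s by rewrite /h divfK// gt_eqF.
have hF j : `|h * (F x 0 j - F y 0 j)| < (r - s) * eta 0 j.
  by rewrite normrM gtr0_norm// -hB -mulrA ltr_pM2l.
have hc : 0 <= h * c by rewrite mulr_ge0// ltW.
have hc1 : 0 < 1 + h * c by lra.
have : Ninf (x - y + h *: (F x - F y)) < (1 + h * c) * r.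
  apply: wnorminf_lt => [|j]; first by rewrite mulr_gt0.
  rewrite !mxE; have [->|ji] := eqVneq j i.
    rewrite xyi; have := hF i; rewrite ltr_norml => /andP[h1 _].
    have hlt : h * (F x 0 i - F y 0 i) < h * (c * (r * eta 0 i)) by rewrite ltr_pM2l.
    have se : 0 <= s * eta 0 i by rewrite mulr_ge0// ltW.
    by rewrite ger0_norm; lra.
  rewrite (le_lt_trans (ler_normD _ _))//.
  have := xys j ji; have := hF j => h1 h2.
  have : 0 <= h * c * (r * eta 0 j) by rewrite mulr_ge0// mulr_ge0// ?(ltW r0)// ltW.
  lra.
apply/negP; rewrite -leNgt (le_trans _ (accF h x y (ltW h0)))// ler_pM2l//.
rewrite -(@ler_pM2r _ (eta 0 i))// (le_trans _ (wnorminf_coord _ i))//.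
by rewrite !mxE xyi ler_norm.
Qed.

(* Increasing the [i]-th coordinate of [u] does not decrease the [i]-th coordinate of
   [step u]; do it until [i] is the only coordinate realizing the norm of the
   difference with [v], where accretivity bounds [F] from below. *)
Lemma wnorminf_step x y : accretive Ninf F c ->
  Ninf (step x - step y) <= (1 - a * c) * Ninf (x - y).
Proof.
move=> accF.
have key (u v : V) i e : 0 < e ->
    step u 0 i - step v 0 i <= (1 - a * c) * ((Ninf (u - v) + e) * eta 0 i).
  move=> e0; set r := Ninf (u - v).
  have r0 : 0 <= r by exact: wnorminf_ge0.
  have uv j : `|u 0 j - v 0 j| <= r * eta 0 j.
    by have := wnorminf_coord (u - v) j; rewrite !mxE.
  have ee : 0 < e * eta 0 i by rewrite mulr_gt0.
  pose t := v 0 i + (r + e) * eta 0 i - u 0 i.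
  have t0 : 0 <= t by have := uv i; rewrite ler_norml => /andP[_]; rewrite /t; lra.
  pose w := u + t *: delta_mx 0 i.
  have wi : w 0 i - v 0 i = (r + e) * eta 0 i by rewrite /w !mxE !eqxx mulr1 /t; ring.
  have wj j : j != i -> w 0 j = u 0 j.
    by move=> ji; rewrite /w !mxE (negbTE ji) andbF mulr0 addr0.
  have := @wnorminf_slope w v i (r + e) accF _ wi.
  rewrite ltr_wpDl// => /(_ isT) h1.
  have {h1} h1 : c * ((r + e) * eta 0 i) <= F w 0 i - F v 0 i.
    by apply: h1; exists r; [rewrite ltrDl|move=> j ji; rewrite wj].
  have h2 := slope i u t0; rewrite -/w in h2.
  have h3 : a * (F w 0 i - F u 0 i) <= t.
    rewrite (@le_trans _ _ (a * (D * t)))//; first by rewrite ler_pM2l.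
    by rewrite mulrA ler_piMl.
  have h4 : a * (c * ((r + e) * eta 0 i)) <= a * (F w 0 i - F v 0 i) by rewrite ler_pM2l.
  have wu : w 0 i = u 0 i + t by rewrite /w !mxE !eqxx mulr1.
  rewrite /step !mxE; move: wi h3 h4; rewrite wu; lra.
have key0 (u v : V) i : step u 0 i - step v 0 i <= (1 - a * c) * (Ninf (u - v) * eta 0 i).
  apply/ler_addgt0Pr => e e0.
  have C0 : 0 < `|1 - a * c| * eta 0 i + 1 by rewrite ltr_wpDl// mulr_ge0// ltW.
  rewrite (le_trans (key u v i _ (divr_gt0 e0 C0)))// [_ * eta 0 i]mulrDl mulrDr lerD2l.
  rewrite (@le_trans _ _ (`|1 - a * c| * eta 0 i * (e / (`|1 - a * c| * eta 0 i + 1))))//.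
    rewrite [_ * eta 0 i]mulrC mulrA ler_wpM2r//; first by rewrite divr_ge0// ltW.
    by rewrite ler_pM2r// ler_norm.
  by rewrite mulrCA ger_pMr// ler_pdivrMr// mul1r lerDl.
have abs i : `|step x 0 i - step y 0 i| <= (1 - a * c) * (Ninf (x - y) * eta 0 i).
  rewrite ler_norml key0 andbT lerNl opprB (le_trans (key0 y x i))//.
  by rewrite -[y - x]opprB -[- (x - y)]scaleN1r wnormZ normrN1 mul1r.
(* [a * c <= 1] is not assumed; it is deduced later from this contraction. If it fails, [abs] forces
   [x = y]. *)
have [q0|q0] := leP 0 (1 - a * c).
  apply: wnorminf_le => [|i]; first by rewrite mulr_ge0// wnorminf_ge0.
  have := abs i; rewrite mulrA; congr (`|_| <= _).
  by rewrite [RHS]mxE [X in _ = _ + X]mxE.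
have xy0 i : x 0 i = y 0 i.
  have := abs i; have : (1 - a * c) * (Ninf (x - y) * eta 0 i) <= 0.
    by rewrite nmulr_rle0// mulr_ge0// ?wnorminf_ge0// ltW.
  move=> h1 h2; have h3 : Ninf (x - y) * eta 0 i <= 0.
    by rewrite -(@nmulr_rge0 _ (1 - a * c))// (le_trans _ h2).
  have := wnorminf_coord (x - y) i; rewrite !mxE => h4.
  apply/eqP; rewrite -subr_eq0 -normr_le0; exact: le_trans h4 h3.
have -> : x = y by apply/rowP.
by rewrite !subrr -(scale0r (0 : V)) wnormZ normr0 !mul0r mulr0.
Qed.

(* At a pair differing in one coordinate, accretivity only bounds [F] with the
   sign [+] in front of the sum; moving the other coordinates slightly against the
   sign of [dF] turns it into [-]. *)
Lemma wnorm1_slope (x : V) j t : accretive N1 F c -> 0 < t ->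
  c * (eta 0 j * t) <= eta 0 j * (F (x + t *: delta_mx 0 j) 0 j - F x 0 j)
    - \sum_(i | i != j) eta 0 i * `|F (x + t *: delta_mx 0 j) 0 i - F x 0 i|.
Proof.
move=> accF t0; set y := x + _.
pose dF i := F y 0 i - F x 0 i; rewrite -/(dF j).
have main d : 0 < d -> c * (eta 0 j * t) <=
    eta 0 j * (dF j + `|L| * d) + \sum_(i | i != j) eta 0 i * (`|L| * d - `|dF i|).
  move=> d0; set l := `|L| * d.
  pose w : V := \row_i (if i == j then 0 else - Num.sg (dF i)).
  have w1 : `|w| <= 1.
    apply: rV_norm_le => // i; rewrite mxE; case: ifP => _; first by rewrite normr0.
    by rewrite normrN normr_sg lern1; case: (_ != 0).
  pose y' := y + d *: w; pose dF' i := F y' 0 i - F x 0 i.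
  have dF'E i : `|dF' i - dF i| <= l.
    rewrite /dF' /dF opprB addrA subrK.
    have := rV_coord_le (F y' - F y) i; rewrite !mxE => /le_trans; apply.
    rewrite (le_trans (FL _ _))// /y' addrAC subrr add0r normrZ gtr0_norm//.
    rewrite (le_trans (ler_wpM2r _ (ler_norm L))) ?mulr_ge0// ?(ltW d0)//.
    by rewrite /l ler_wpM2l// ler_piMr// ltW.
  pose B := `|F y' - F x| + 1.
  have B0 : 0 < B by rewrite ltr_wpDl.
  have FB i : `|dF' i| <= B.
    have := rV_coord_le (F y' - F x) i; rewrite !mxE => /le_trans; apply.
    by rewrite lerDl.
  (* With this [h], no nonzero coordinate of [y' - x] changes sign under the step, so the absolute
     values can be opened. *)
  pose h := Num.min t d / B.
  have td0 : 0 < Num.min t d by rewrite lt_min t0.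
  have h0 : 0 < h by rewrite divr_gt0.
  have hF i : `|h * dF' i| <= Num.min t d.
    by rewrite normrM gtr0_norm// /h mulrAC ler_pdivrMr// ler_wpM2l ?FB// ltW.
  have hFt i : `|h * dF' i| <= t by rewrite (le_trans (hF i))// ge_min lexx.
  have hFd i : `|h * dF' i| <= d by rewrite (le_trans (hF i))// ge_min lexx orbT.
  have := accF h y' x (ltW h0).
  have E i : (y' - x) 0 i = t * (i == j)%:R + d * w 0 i.
    by rewrite !mxE eqxx; ring.
  have E' i : (y' - x + h *: (F y' - F x)) 0 i = t * (i == j)%:R + d * w 0 i + h * dF' i.
    by rewrite [LHS]mxE E !mxE.
  have wj : w 0 j = 0 by rewrite mxE eqxx.
  rewrite /= (bigD1 j)//= [in leRHS](bigD1 j)//= E E' eqxx mulr1 wj mulr0 addr0.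
  rewrite gtr0_norm//.
  have -> : \sum_(i | i != j) eta 0 i * `|(y' - x) 0 i| = \sum_(i | i != j) eta 0 i * (d * `|w 0 i|).
    apply: eq_bigr => i ij; rewrite E (negbTE ij) mulr0 add0r normrM.
    by rewrite (gtr0_norm d0).
  have tj : `|t + h * dF' j| = t + h * dF' j.
    by rewrite ger0_norm//; have := hFt j; rewrite ler_norml => /andP[? _]; lra.
  rewrite tj.
  have le2 : \sum_(i | i != j) eta 0 i * `|(y' - x + h *: (F y' - F x)) 0 i| <=
     \sum_(i | i != j) eta 0 i * (d * `|w 0 i|) + h * \sum_(i | i != j) eta 0 i * (l - `|dF i|).
    rewrite mulr_sumr -big_split /=; apply: ler_sum => i ij.
    rewrite [h * (_ * _)]mulrCA -mulrDr ler_pM2l// E' (negbTE ij) mulr0 add0r.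
    have := dF'E i; rewrite ler_norml => /andP[e1 e2].
    have := hFd i; rewrite ler_norml => /andP[e3 e4].
    have e5 : h * (dF i - l) <= h * dF' i by rewrite ler_pM2l//; lra.
    have e6 : h * dF' i <= h * (dF i + l) by rewrite ler_pM2l//; lra.
    rewrite mxE (negbTE ij); case: (ltgtP (dF i) 0) => di.
    - rewrite ltr0_sg// opprK normr1 !mulr1 [`|dF i|]ltr0_norm// ger0_norm; lra.
    - rewrite gtr0_sg// normrN1 mulr1 mulrN1 [`|dF i|]gtr0_norm// ler0_norm; lra.
    - rewrite di sgr0 oppr0 normr0 !mulr0 !add0r subr0 ler_norml; apply/andP.
      by move: e5 e6; rewrite di; split; lra.
  have ge0 : 0 <= \sum_(i | i != j) eta 0 i * (d * `|w 0 i|).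
    by apply: sumr_ge0 => i _; rewrite !mulr_ge0// ltW.
  have hc : 0 <= h * c by rewrite mulr_ge0// ltW.
  move=> acc; rewrite -(@ler_pM2l _ h)//.
  have := dF'E j; rewrite ler_norml => /andP[_ e2].
  have e3 : h * (eta 0 j * dF' j) <= h * (eta 0 j * (dF j + l)).
    by rewrite ler_pM2l// ler_pM2l//; lra.
  have e4 : 0 <= h * c * \sum_(i | i != j) eta 0 i * (d * `|w 0 i|) by rewrite mulr_ge0.
  lra.
(* The terms in [|L| * d], due to evaluating [F] at [y'] instead of [y], vanish with [d]. *)
apply/ler_addgt0Pr => e e0.
pose W := \sum_i eta 0 i.
have W0 : 0 <= W by apply: sumr_ge0 => i _; exact: ltW.
have C0 : 0 < `|L| * W + 1 by rewrite ltr_wpDl// mulr_ge0.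
have := main _ (divr_gt0 e0 C0); set d := e / _ => /le_trans; apply.
rewrite -lerBlDl.
have -> : eta 0 j * (dF j + `|L| * d) + \sum_(i | i != j) eta 0 i * (`|L| * d - `|dF i|) -
   (eta 0 j * dF j - \sum_(i | i != j) eta 0 i * `|dF i|) = `|L| * W * d.
  have -> : W = eta 0 j + \sum_(i | i != j) eta 0 i by rewrite /W (bigD1 j).
  have -> : \sum_(i | i != j) eta 0 i * (`|L| * d - `|dF i|) =
     (\sum_(i | i != j) eta 0 i) * (`|L| * d) - \sum_(i | i != j) eta 0 i * `|dF i|.
    by rewrite mulr_suml -sumrB; apply: eq_bigr => i _; rewrite mulrBr.
  ring.
by rewrite /d mulrCA ger_pMr// ler_pdivrMr// mul1r lerDl.
Qed.

(** For [t > 0], the slope bound and [a * D <= 1] make the [j]-th coordinate of the difference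
    nonnegative; its absolute value opens and [a] times [wnorm1_slope] concludes. For [t < 0] the
    endpoints are exchanged. *)
Lemma wnorm1_coord_step (x : V) j t : accretive N1 F c ->
  N1 (step (x + t *: delta_mx 0 j) - step x) <= (1 - a * c) * (eta 0 j * `|t|).
Proof.
move=> accF.
have pos (u : V) s : 0 < s ->
    N1 (step (u + s *: delta_mx 0 j) - step u) <= (1 - a * c) * (eta 0 j * s).
  move=> s0; have h1 := wnorm1_slope u j accF s0.
  have h2 := slope j u (ltW s0).
  set v := u + _ in h1 h2 *.
  have E i : (step v - step u) 0 i = s * (i == j)%:R - a * (F v 0 i - F u 0 i).
    by rewrite /step /v !mxE eqxx; ring.
  have h3 : a * (F v 0 j - F u 0 j) <= s.
    rewrite (@le_trans _ _ (a * (D * s)))//; first by rewrite ler_pM2l.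
    by rewrite mulrA ler_piMl// ltW.
  rewrite /= (bigD1 j)//= E eqxx mulr1 ger0_norm ?subr_ge0//.
  have -> : \sum_(i | i != j) eta 0 i * `|(step v - step u) 0 i| =
     a * \sum_(i | i != j) eta 0 i * `|F v 0 i - F u 0 i|.
    rewrite mulr_sumr; apply: eq_bigr => i ij.
    by rewrite E (negbTE ij) mulr0 sub0r normrN normrM gtr0_norm// mulrCA.
  rewrite -(@ler_pM2l _ a)// in h1; lra.
have [t0|t0|->] := ltgtP t 0.
- have := pos (x + t *: delta_mx 0 j) (- t); rewrite oppr_gt0 => /(_ t0).
  have -> : x + t *: delta_mx 0 j + - t *: delta_mx 0 j = x.
    by rewrite -addrA -scalerDl subrr scale0r addr0.
  rewrite ltr0_norm//; apply: le_trans.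
  by rewrite -(opprB (step x)) -scaleN1r wnormZ normrN1 mul1r.
- by rewrite gtr0_norm//; exact: pos.
- rewrite scale0r addr0 subrr normr0 !mulr0 /= big1// => i _.
  by rewrite mxE normr0 mulr0.
Qed.

(* [N1] is additive along a path changing one coordinate at a time. *)
Lemma wnorm1_step x y : accretive N1 F c ->
  N1 (step x - step y) <= (1 - a * c) * N1 (x - y).
Proof.
move=> accF.
pose z k : V := \row_i (if (i < k)%N then x 0 i else y 0 i).
have zn : z n = x by apply/rowP => i; rewrite mxE ltn_ord.
have z0 : z 0%N = y by apply/rowP => i; rewrite mxE.
have zS (k : 'I_n) : z k.+1 = z k + (x 0 k - y 0 k) *: delta_mx 0 k.
  apply/rowP => i; rewrite !mxE eqxx /= ltnS leq_eqVlt -val_eqE /=.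
  case: ltngtP => //= ik; rewrite ?mulr0 ?addr0// mulr1 addrCA.
  by rewrite (val_inj ik) subrr addr0.
have -> : step x - step y = \sum_(k < n) (step (z k.+1) - step (z k)).
  by rewrite -(big_mkord xpredT (fun k => step (z k.+1) - step (z k))) telescope_sumr// zn z0.
have le_sum (I : Type) (r : seq I) (f : I -> V) :
    N1 (\sum_(i <- r) f i) <= \sum_(i <- r) N1 (f i).
  elim/big_ind2 : _ => [|u1 u2 v1 v2 h1 h2|//].
    by rewrite -(scale0r (0 : V)) wnormZ normr0 mul0r.
  by rewrite (le_trans (wnormD _ _ _))// lerD.
rewrite (le_trans (le_sum _ _ _))// [X in _ <= _ * X]/= mulr_sumr.
apply: ler_sum => k _; rewrite zS.
by have := wnorm1_coord_step (z k) k (x 0 k - y 0 k) accF; rewrite !mxE.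
Qed.

Lemma wnorm_step k x y : accretive (wnorm k eta) F c ->
  wnorm k eta (step x - step y) <= (1 - a * c) * wnorm k eta (x - y).
Proof. by case: k; [exact: wnorm1_step|exact: wnorminf_step]. Qed.

End Contraction.
End WeightedNorms.

(** * Consequences of monotonicity and of Lipschitz continuity *)

Section Monotone.
Variables (R : realType) (n : nat).
Local Notation V := 'rV[R]_n.

(** Write [d] as [(d + h u) + h (- u)]: subadditivity in the first argument, then Cauchy-Schwarz,
    leave a common factor [N d] to cancel. *)
Lemma monotone_accretive (N : V -> R) (H : V -> V) (c : R) :
  (forall x, 0 <= N x) -> monotone_with N H c -> accretive N H c.
Proof.
move=> N0 [wp [[subadd [_ [hom [_ [_ [cs [comp _]]]]]]] mon]] h x y h0.
set d := x - y; set u := H x - H y.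
have d2 : N d ^+ 2 <= wp (d + h *: u) d + h * wp (- u) d.
  rewrite -comp -(hom h (- u) d h0).1.
  have {1}-> : d = d + h *: u + h *: - u by rewrite scalerN addrK.
  exact: subadd.
have cs1 : wp (d + h *: u) d <= N (d + h *: u) * N d.
  have := cs (d + h *: u) d; rewrite !comp !sqrtr_sqr [`|N d|]ger0_norm// [`|N (_ + _)|]ger0_norm//.
  by move/(le_trans (ler_norm _)).
have hm : h * wp (- u) d <= - (h * (c * N d ^+ 2)).
  by have := ler_wpM2l h0 (mon x y); rewrite -/d -/u; lra.
have : (1 + h * c) * N d * N d <= N (d + h *: u) * N d.
  by move: d2 cs1 hm; rewrite expr2; lra.
have [Nd _|d0] := eqVneq (N d) 0; first by rewrite Nd mulr0.
by rewrite ler_pM2r// lt_def d0 N0.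
Qed.

(** [sup] takes a default value on unbounded sets, so [diagL F] bounds the diagonal entries only
    once they are known to be bounded. The 1 is the tolerance taken in the first-order expansion. *)
Lemma jacobian_le (F : V -> V) L x i : (forall x y, `|F x - F y| <= L * `|x - y|) ->
  differentiable F x -> jacobian F x i i <= L + 1.
Proof.
move=> FL /diff_locally /(@eqaddoP R V V V) /(_ 1 ltr01) /(@nbhs_normP R V)[d /= d0 dP].
pose e : V := delta_mx 0 i.
have e1 : `|e| <= 1.
  by apply: rV_norm_le => // j; rewrite mxE eqxx /=; case: eqP; rewrite ?normr1 ?normr0.
pose t := d / 2.
have t0 : 0 < t by rewrite divr_gt0.
have te : `|t *: e| <= t by rewrite normrZ gtr0_norm// ler_piMr// ltW.
have h : `|F (t *: e + x) - (F x + 'd F x (t *: e))| <= t.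
  apply: le_trans (te); rewrite -[leRHS]mul1r; apply: dP.
  by rewrite /= sub0r normrN (le_lt_trans te)// /t ltr_pdivrMr// ltr_pMr// ltr1n.
have h1 := le_trans (rV_coord_le _ i) h.
have h2 := le_trans (rV_coord_le (F (t *: e + x) - F x) i) (FL _ _).
have L0 : 0 <= L.
  have := le_trans (normr_ge0 _) (FL e 0); rewrite subr0.
  have ei : 1 <= `|e| by have := rV_coord_le e i; rewrite mxE !eqxx normr1.
  by rewrite pmulr_lge0// (lt_le_trans ltr01).
have h3 : L * `|t *: e + x - x| <= L * t by rewrite addrK ler_wpM2l.
have {}h2 := le_trans h2 h3.
rewrite mxE -/e; move: h1 h2; rewrite linearZ !mxE !ler_norml => /andP[h1 _] /andP[_ h2].
rewrite -(@ler_pM2l _ t)//; lra.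
Qed.

End Monotone.

(** * Resolvents and convergence of the two iterations *)

Unset Implicit Arguments.

Theorem theorem33 (R : realType) (n : nat) (hn : (0 < n)%N)
  (k : wkind) (eta : 'rV[R]_n) (heta : forall i, 0 < eta 0 i)
  (F G : 'rV[R]_n -> 'rV[R]_n) (x0 : 'rV[R]_n) :
  let N := wnorm k eta in
  lipschitz_wrt N F ->
  continuous G ->
  monotone_with N G 0 ->
  (* (i) *)
  (forall c : R, 0 < c -> monotone_with N F c ->
     0 < diagL F /\
     exists xs : 'rV[R]_n,
       F xs + G xs = 0 /\
       (forall z, F z + G z = 0 -> z = xs) /\
       (forall a : R, 0 < a <= (diagL F)^-1 ->
          fb_iter a F G x0 @ \oo --> xs /\
          (forall m : nat,
             N (fb_iter a F G x0 m.+1 - xs) <= (1 - a * c) * N (fb_iter a F G x0 m - xs)) /\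
          1 - (diagL F)^-1 * c <= 1 - a * c)) /\
  (* (ii) *)
  (monotone_with N F 0 -> (exists z, F z + G z = 0) ->
     forall a : R, 0 < a <= (diagL F)^-1 ->
       exists z, F z + G z = 0 /\ fb_avg_iter a F G x0 @ \oo --> z).
Proof.
move=> N [L FL] cG monG.
have [lo0 up0] := wnorm_pos heta.
set lo := (_^-1) in lo0; set up := (X in 0 < X) in up0.
have Nlo x : lo * `|x| <= N x by exact: wnorm_lo.
have Nup x : N x <= up * `|x| by exact: wnorm_up.
have ND x y : N (x + y) <= N x + N y by exact: wnormD.
have NZ b x : N (b *: x) = `|b| * N x by exact: wnormZ.
have N0 x : 0 <= N x := N_ge0 lo0 Nlo x.
clearbody lo up.
pose L' := lo^-1 * (`|L| * up).
have FL' x y : `|F x - F y| <= L' * `|x - y|.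
  rewrite -mulrA ler_pdivlMl// (le_trans (Nlo _))// (le_trans (FL _ _))//.
  rewrite (le_trans (ler_wpM2r (N0 _) (ler_norm L)))// -mulrA ler_wpM2l//.
have cF : continuous F by exact: (@lip_continuous R _ _ F L' FL').
have accG : accretive N G 0 by exact: monotone_accretive.
have slope i x t : 0 <= t -> F (x + t *: delta_mx 0 i) 0 i - F x 0 i <= diagL F * t.
  apply: (rademacher_coordinate FL') => y dF.
  apply: ub_le_sup; last by exists y, i.
  by exists (L' + 1) => _ [z [j [dz ->]]]; exact: jacobian_le.
have contr c a x y : 0 <= c -> 0 < a -> a * diagL F <= 1 -> accretive N F c ->
    N ((x - a *: F x) - (y - a *: F y)) <= (1 - a * c) * N (x - y).
  by move=> c0 a0 aD; exact: (wnorm_step heta FL' slope).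
(* [Id + a G] is strongly accretive with parameter 1: factor out [1 + h] and use accretivity of [G]
   at [h a / (1 + h)]. *)
have resex a b : 0 < a -> exists x, x + a *: G x = b.
  move=> a0.
  apply: (accretive_surj ND NZ lo0 Nlo up0 Nup (H := fun x => x + a *: G x) b _ ltr01).
    by apply: (@continuous_add_scale R _ id G a) => // x; exact: cvg_id.
  move=> h x y h0; rewrite mulr1.
  have h10 : 0 < 1 + h by rewrite ltr_pwDl.
  have -> : x - y + h *: (x + a *: G x - (y + a *: G y)) =
     (1 + h) *: (x - y + (h * a / (1 + h)) *: (G x - G y)).
    rewrite [RHS]scalerDr scalerA mulrCA divff ?gt_eqF// mulr1.
    by apply/rowP => i; rewrite !mxE; ring.
  rewrite NZ gtr0_norm// ler_pM2l//.
  have := accG (h * a / (1 + h)) x y; rewrite mulr0 addr0 mul1r; apply.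
  by rewrite divr_ge0 ?mulr_ge0// ltW.
have resP a b : 0 < a -> resolvent a G b + a *: G (resolvent a G b) = b.
  by move=> a0; have := getPex (resex a b a0).
have resN a u v : 0 < a -> N (resolvent a G u - resolvent a G v) <= N (u - v).
  move=> a0; have := accG a (resolvent a G u) (resolvent a G v) (ltW a0).
  rewrite mulr0 addr0 mul1r => /le_trans; apply.
  rewrite -{3}[u](resP a _ a0) -{3}[v](resP a _ a0) scalerBr.
  by rewrite opprD addrACA.
have resI a x b : 0 < a -> x + a *: G x = b -> resolvent a G b = x.
  move=> a0 xb; apply/eqP; rewrite -subr_eq0; apply/eqP.
  apply: (N_eq0 lo0 Nlo).
  have := accG a (resolvent a G b) x (ltW a0).
  rewrite mulr0 addr0 mul1r => /le_trans; apply.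
  rewrite scalerBr addrACA -opprD resP// xb subrr.
  by rewrite (N_0 NZ).
have fix_zero a z : 0 < a -> F z + G z = 0 <-> resolvent a G (z - a *: F z) = z.
  move=> a0; split => [z0|zE].
    apply: resI => //; congr (_ + _); rewrite -scalerN; congr (_ *: _).
    by apply/eqP; rewrite -addr_eq0 addrC z0.
  have := resP a (z - a *: F z) a0; rewrite zE => /addrI /eqP.
  rewrite -subr_eq0 opprK -scalerDr scaler_eq0 gt_eqF//= => /eqP.
  by rewrite addrC.
pose one : 'rV[R]_n := const_mx 1.
have one0 : 0 < N one.
  rewrite lt_def N0 andbT; apply/eqP => /eqP; rewrite eq_le => /andP[/(N_eq0 lo0 Nlo)/rowP/(_ (Ordinal hn)) + _].
  by rewrite !mxE => /eqP; rewrite oner_eq0.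
split=> [c c0 /(monotone_accretive N0) accF|/(monotone_accretive N0) accF [z z0] a /andP[a0 aD]].
  (* The contraction tested on [one] and 0, which are distinct since [n > 0], shows [a * c <= 1]. *)
  have q0 a : 0 < a -> a * diagL F <= 1 -> 0 <= 1 - a * c.
    move=> a0 aD; have := contr c a one 0 (ltW c0) a0 aD accF; rewrite subr0.
    by move=> /(le_trans (N0 _)); rewrite pmulr_lge0.
  (* If [diagL F <= 0], every positive step would be admissible, and [a = 2 / c] contradicts
     [a * c <= 1]. *)
  have D0 : 0 < diagL F.
    rewrite ltNge; apply/negP => D0.
    have h1 : 2 / c * diagL F <= 1.
      by rewrite (le_trans _ ler01)// mulr_ge0_le0// divr_ge0// ltW.
    have := q0 _ (divr_gt0 (ltr0n R 2) c0) h1.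
    have -> : 2 / c * c = 2 by rewrite divfK// gt_eqF.
    lra.
  split => //.
  have rangeD a : a <= (diagL F)^-1 -> a * diagL F <= 1.
    by move=> aD; rewrite -ler_pdivlMr// div1r.
  (* With [s = h / a], the expansion of [F + G] plus [s] times the difference of [Id - a F] is
     [1 + s] times an expansion of [G] alone. Accretivity of [G] bounds it below, the contraction
     bounds the [Id - a F] term above. *)
  have accFG : accretive N (fun x => F x + G x) c.
    pose a := (diagL F)^-1; have a0 : 0 < a by rewrite invr_gt0.
    move=> h x y h0.
    have cF1 := contr c a x y (ltW c0) a0 (rangeD _ (lexx _)) accF.
    have ha0 : 0 <= h / a by rewrite divr_ge0// ltW.
    have h10 : 0 < 1 + h / a by rewrite ltr_pwDl.
    have := accG (h / (1 + h / a)) x y; rewrite mulr0 addr0 mul1r divr_ge0 ?(ltW h10)// => /(_ isT).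
    rewrite -(@ler_pM2l _ (1 + h / a))// -[X in _ <= X * _ -> _]gtr0_norm// -NZ.
    have -> : (1 + h / a) *: (x - y + (h / (1 + h / a)) *: (G x - G y)) =
        (x - y + h *: (F x + G x - (F y + G y))) + (h / a) *: ((x - a *: F x) - (y - a *: F y)).
      rewrite [LHS]scalerDr scalerA mulrCA divff ?gt_eqF// mulr1.
      have ha : h = h / a * a by rewrite divfK// gt_eqF.
      rewrite {2 3}ha; move: (h / a) => s.
      by apply/rowP => i; rewrite !mxE; ring.
    move=> /le_trans /(_ (ND _ _)); rewrite NZ ger0_norm//.
    have := ler_wpM2l ha0 cF1.
    have -> : h / a * ((1 - a * c) * N (x - y)) = h / a * N (x - y) - h * c * N (x - y).
      by field; rewrite gt_eqF.
    lra.
  have [xs xsE] : exists xs, F xs + G xs = 0.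
    apply: (accretive_surj ND NZ lo0 Nlo up0 Nup (H := fun x => F x + G x) 0 _ c0 accFG).
    have := @continuous_add_scale R _ F G 1 cF cG.
    by under eq_fun do rewrite scale1r.
  exists xs; split => //; split.
    move=> z zE; apply/eqP; rewrite -subr_eq0; apply/eqP; apply: (N_eq0 lo0 Nlo).
    have := accFG 1 z xs ler01; rewrite zE xsE subrr scaler0 addr0 mul1r => h.
    by rewrite -(@pmulr_rle0 _ c)//; move: h; rewrite mulrDl mul1r gerDl.
  move=> a /andP[a0 aD]; have aD1 := rangeD _ aD.
  have rate m : N (fb_iter a F G x0 m.+1 - xs) <= (1 - a * c) * N (fb_iter a F G x0 m - xs).
    rewrite -[in leLHS]((fix_zero a xs a0).1 xsE) (le_trans (resN _ _ _ a0))//.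
    exact: contr (ltW c0) a0 aD1 accF.
  split; last first.
    split => //; rewrite lerD2l lerN2 ler_pM2r//.
  have qq := q0 a a0 aD1.
  have pow m : N (fb_iter a F G x0 m - xs) <= N (x0 - xs) * (1 - a * c) ^+ m.
    elim: m => [|m IH]; first by rewrite mulr1.
    by rewrite (le_trans (rate m))// exprS mulrCA ler_wpM2l.
  apply: (N_cvg lo0 Nlo) => e e0.
  have [|K KP] := @geometric_le R (1 - a * c) (N (x0 - xs)) e _ e0.
    by rewrite qq/= ltrBlDr ltrDl mulr_gt0.
  by exists K => m /KP; exact: le_trans (pow m).
(* Here positivity comes from the range of [a], which makes [(diagL F)^-1] positive; the convention
   [0^-1 = 0] excludes 0 as well. *)
have D0 : 0 < diagL F by rewrite -invr_gt0 (lt_le_trans a0).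
have aD1 : a * diagL F <= 1 by rewrite -ler_pdivlMr// div1r.
pose T x := resolvent a G (x - a *: F x).
have TN u v : N (T u - T v) <= N (u - v).
  rewrite (le_trans (resN _ _ _ a0))//.
  by have := contr 0 a u v (lexx _) a0 aD1 accF; rewrite mulr0 subr0 mul1r.
have [p [Tp xp]] := km_cvg ND NZ lo0 Nlo up0 Nup TN
  (fun m => erefl : fb_avg_iter a F G x0 m.+1 = _) ((fix_zero a z a0).1 z0).
by exists p; split => //; apply/(fix_zero a p a0).
Qed.
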